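(* For any $\theta\in(0,\frac{\pi}{2})$, $\mathcal{N}(\Delta^{\mathsf{Dir}}_{\Omega_\theta},1)$ is finite.
   Context: For $\theta\in(0,\frac{\pi}{2})$ the broken guide is $$\Omega_\theta=\Big\{(x_1,x_2)\in\mathbb{R}^2:\ x_1\tan\theta<|x_2|<\Big(x_1+\frac{\pi}{\sin\theta}\Big)\tan\theta\Big\}.$$ $\Delta^{\mathsf{Dir}}_{\Omega_\theta}$ denotes the positive Dirichlet Laplacian on $\Omega_\theta$: the self-adjoint operator $\psi\mapsto-\Delta\psi$ on $L^2(\Omega_\theta)$ with domain $\{\psi\in H^1_0(\Omega_\theta):\ \Delta\psi\in L^2(\Omega_\theta)\}$. For a self-adjoint operator $A$, bounded from below, on a Hilbert space $H$, its Rayleigh quotients are, for $j\ge1$, $$\lambda_j=\inf_{\substack{u_1,\dots,u_j\in\mathrm{Dom}(A)\\ \text{linearly independent}}}\ \sup_{u\in[u_1,\dots,u_j]\setminus\{0\}}\frac{\langle Au,u\rangle_H}{\langle u,u\rangle_H},$$ where $[u_1,\dots,u_j]$ is the linear span of $u_1,\dots,u_j$. For $\lambda\in\mathbb{R}$, $\mathcal{N}(A,\lambda)$ denotes the maximal index $j$ such that the $j$-th Rayleigh quotient of $A$ is $<\lambda$ (with value $0$ if there is no such $j$ and $\infty$ if there are infinitely many). *)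

(* Defs.v *)
From mathcomp Require Import all_boot all_order all_algebra.
From mathcomp Require Import all_classical all_reals all_analysis.
From mathcomp Require Import complex.

Set Implicit Arguments.
Unset Strict Implicit.
Unset Printing Implicit Defensive.

Import Order.TTheory GRing.Theory Num.Theory.
Import numFieldNormedType.Exports.

Local Open Scope classical_set_scope.
Local Open Scope ring_scope.

(* Elements of L^2(Omega) = L^2(Omega; C) are represented by functions on the
   whole plane whose values outside Omega are irrelevant: all integrals are
   over Omega, and equality in L^2(Omega) is equality a.e. on Omega. *)

Definition leb2 (R : realType) :
    {measure set (measurableTypeR R * measurableTypeR R) -> \bar R} :=
  ((@lebesgue_measure R) \x (@lebesgue_measure R))%E.
Arguments leb2 : clear implicits.

Section SobolevReal.
Variable R : realType.
Implicit Types (Omega : set (R * R)) (f g h phi : R * R -> R).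

Definition e1 : R * R := (1, 0).
Definition e2 : R * R := (0, 1).

Definition int2 Omega f : R := \int[leb2 R]_(x in Omega) f x.

Definition L2 Omega f : Prop :=
  measurable_fun Omega f /\
  (leb2 R).-integrable Omega (fun x => (f x ^+ 2)%:E).

Fixpoint Ck (k : nat) f : Prop :=
  continuous f /\
  if k is k'.+1
  then forall v : R * R, (forall x, derivable f x v) /\ Ck k' ('D_v f)
  else True.

Definition supp f : set (R * R) := closure [set x | f x != 0].

Definition test_function Omega phi : Prop :=
  [/\ forall k, Ck k phi, compact (supp phi) & supp phi `<=` Omega].

Definition weak_partial Omega (v : R * R) f g : Prop :=
  forall phi, test_function Omega phi ->
    int2 Omega (fun x => f x * 'D_v phi x) =
    - int2 Omega (fun x => g x * phi x).

Definition weak_laplacian Omega f h : Prop :=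
  forall phi, test_function Omega phi ->
    int2 Omega (fun x => f x * ('D_e1 ('D_e1 phi) x + 'D_e2 ('D_e2 phi) x)) =
    int2 Omega (fun x => h x * phi x).

(* H^1_0(Omega): the closure of C_c^oo(Omega) in H^1(Omega). *)
Definition H10 Omega f : Prop :=
  L2 Omega f /\
  exists g1 g2,
    [/\ L2 Omega g1 /\ L2 Omega g2,
        weak_partial Omega e1 f g1,
        weak_partial Omega e2 f g2 &
        forall eps : R, 0 < eps ->
          exists2 phi, test_function Omega phi &
            (\int[leb2 R]_(x in Omega)
               ((f x - phi x) ^+ 2 + (g1 x - 'D_e1 phi x) ^+ 2
                + (g2 x - 'D_e2 phi x) ^+ 2)%:E < eps%:E)%E].

End SobolevReal.

Section OperatorsOnL2.
Variable R : realType.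
Implicit Types (Omega : set (R * R)) (u v f : R * R -> R[i]).

Definition re u : R * R -> R := fun x => complex.Re (u x).
Definition im u : R * R -> R := fun x => complex.Im (u x).

Definition inner Omega u v : R[i] :=
  (int2 Omega (re (fun x => u x * (v x)^*)) +i*
   int2 Omega (im (fun x => u x * (v x)^*)))%C.

Definition ae_zero Omega u : Prop :=
  {ae leb2 R, forall x, Omega x -> u x = 0}.

Definition lincomb (j : nat) (u : 'I_j -> R * R -> R[i]) (c : 'I_j -> R[i]) :
  R * R -> R[i] := fun x => \sum_(i < j) c i * u i x.

(* An operator on L^2(Omega) is given by its domain Dom and its action A. *)

(* For symmetric A the quotient is real, so taking its real part only moves it
   from R[i] to R. *)
Definition rayleigh_quotient Omega (A : (R * R -> R[i]) -> (R * R -> R[i])) u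
    : R := complex.Re (inner Omega (A u) u / inner Omega u u).

Definition independent Omega (j : nat) (u : 'I_j -> R * R -> R[i]) : Prop :=
  forall c, ae_zero Omega (lincomb u c) -> forall i, c i = 0.

Definition rayleigh Omega (Dom : set (R * R -> R[i]))
    (A : (R * R -> R[i]) -> (R * R -> R[i])) (j : nat) : \bar R :=
  ereal_inf
    [set ereal_sup
       [set (rayleigh_quotient Omega A w)%:E
          | w in [set w | (exists c, w = lincomb u c) /\ ~ ae_zero Omega w]]
       | u in [set u : 'I_j -> R * R -> R[i] |
                (forall i, Dom (u i)) /\ independent Omega u]].

(* The indices form a set of naturals, so the supremum is the maximal index if
   there is one, 0 if there is no index, and +oo if there are infinitely many. *)
Definition counting_number Omega (Dom : set (R * R -> R[i]))
    (A : (R * R -> R[i]) -> (R * R -> R[i])) (lambda : R) : \bar R :=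
  ereal_sup [set j%:R%:E | j in
    [set j : nat | j = 0%N \/
       (1 <= j)%N /\ (rayleigh Omega Dom A j < lambda%:E)%E]].

(* Real and imaginary parts are treated separately; since test functions may be
   taken real, this is the complex-valued distributional Laplacian. *)
Definition is_laplacian Omega u f : Prop :=
  [/\ L2 Omega (re f), L2 Omega (im f),
      weak_laplacian Omega (re u) (re f) &
      weak_laplacian Omega (im u) (im f)].

Definition dirichlet_dom Omega : set (R * R -> R[i]) :=
  [set u | [/\ H10 Omega (re u), H10 Omega (im u) &
               exists f, is_laplacian Omega u f]].

(* For open Omega the distribution Laplacian(u) determines f a.e. on Omega;
   xget picks one representative. *)
Definition dirichlet_laplacian Omega u : R * R -> R[i] :=
  - xget 0 [set f | is_laplacian Omega u f].

End OperatorsOnL2.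

Definition broken_guide (R : realType) (theta : R) : set (R * R) :=
  [set x | x.1 * tan theta < `|x.2| /\
           `|x.2| < (x.1 + pi / sin theta) * tan theta].

(* Main.v *)
Require Import Defs.
From mathcomp Require Import all_boot all_order all_algebra.
From mathcomp Require Import all_classical all_reals all_analysis.
From mathcomp Require Import ring lra measurable_realfun.

Set Implicit Arguments.
Unset Strict Implicit.
Unset Printing Implicit Defensive.

Import Order.TTheory GRing.Theory Num.Theory.
Import numFieldNormedType.Exports.

Local Open Scope classical_set_scope.
Local Open Scope ring_scope.

(** Each arm of the guide is a half-strip of width pi. On a slice perpendicular
    to the arm and bounded by its two walls a function of H^1_0 vanishes at both
    ends of a segment of length pi, so the Wirtinger inequality, int g'^2 >= int
    g^2, makes the arm contribute nonnegatively to the form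
      q(u) = int |grad u|^2 - int |u|^2.
    The perpendicular slices starting at the reentrant corner cut off the two
    arms ([arm], [poincare_arm]); what remains of the guide is a bounded kite,
    contained in the cone of the points that lie behind both slices.

    The kite is covered by finitely many small parallelograms whose sides are
    parallel to the edges of this cone ([tile]). On a parallelogram of small
    diameter the Poincare inequality bounds int u^2 by int |grad u|^2 plus a
    multiple of (int u)^2 ([poincare_tile]). Extending u by zero outside the guide
    makes it harmless that the parallelograms cross the outer wall. Summing over
    the pieces gives
      int u^2 <= int |grad u|^2 + C sum_T (int_T u)^2
    with finitely many parallelograms T, first for test functions
    ([test_function_inequality]) and then on H^1_0 by density ([H10_inequality]).
    Hence q >= 0 on the functions whose mean over each T vanishes.

    If u is in the domain of the Laplacian, then approximating u by test
    functions turns <-Laplacian u, u> into int |grad u|^2 ([green_le]). In a span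
    of dimension larger than the number of parallelograms some nonzero u has all
    its means equal to zero, and its Rayleigh quotient is at least 1
    ([rayleigh_quotient_ge1]). So the counting function is at most the number of
    parallelograms ([rayleigh_lt1_le_tiles]).

    All computations in the plane use the coordinates (y, w) given by [shear]:
    composed of two shears, this map preserves the measure by the invariance of
    the Lebesgue measure on the line under translations and by the theorem of
    Tonelli, and its coordinate lines can be given the two directions that
    matter. *)

(** * Lebesgue measure on the plane *)

Section PlaneMeasure.
Variable R : realType.
Local Notation mu := (@lebesgue_measure R).
Local Notation MR := (measurableTypeR R).

(** The measurable structure on the plane is that of the product, not the one
    generated by the open sets; rational boxes relate them. *)
Lemma open2_measurable (U : set (R * R)) : open U ->
  measurable (U : set (MR * MR)).
Proof.
move=> oU.
pose box (q : rat * rat * (rat * rat)) : set (MR * MR) :=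
  `](ratr q.1.1 : R), ratr q.1.2[%classic `*` `](ratr q.2.1 : R), ratr q.2.2[%classic.
have -> : U = \bigcup_(q in [set q | box q `<=` U]) box q.
  apply/seteqP; split=> [[x y] Uxy|x [q /= ]]; last exact.
  have := oU; rewrite openE => /(_ _ Uxy); rewrite /interior /=.
  move=> /nbhs_ballP[e /= e0 be].
  have rt (a b : R) : a < b -> exists q : rat, a < ratr q < b.
    move=> ab; have [q] := rat_in_itvoo ab.
    by rewrite in_itv/= => ?; exists q.
  have [q1 /andP[q1a q1b]] := rt (x - e) x ltac:(lra).
  have [q2 /andP[q2a q2b]] := rt x (x + e) ltac:(lra).
  have [q3 /andP[q3a q3b]] := rt (y - e) y ltac:(lra).
  have [q4 /andP[q4a q4b]] := rt y (y + e) ltac:(lra).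
  exists ((q1, q2), (q3, q4)); last first.
    by rewrite /box /=; split; rewrite /= in_itv/= ?q1b ?q2a ?q3b ?q4a.
  move=> [s t] [/=]; rewrite !in_itv/= => /andP[h1 h2] /andP[h3 h4].
  by apply: be; split; rewrite /= /ball/= ltr_norml; lra.
rewrite bigcup_mkcond; apply: countable_bigcupT_measurable => [|q].
  exact: countableP.
by case: ifPn => // _; apply: measurableX; exact: measurable_itv.
Qed.

Lemma continuous2_measurable (f : R * R -> R) : continuous f ->
  measurable_fun setT (f : MR * MR -> R).
Proof.
move=> cf; apply: (measurability _ (RGenOpens.measurableE R)).
move=> _ [_ [a [b ->] <-]]; rewrite setTI.
apply: open2_measurable; apply: open_comp; first by move=> p _; exact: cf.
exact: interval_open.
Qed.

Lemma lebesgue_measure_translation (a : R) (A : set MR) : measurable A ->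
  pushforward mu (fun x : MR => (x + a : MR)) A = mu A.
Proof.
move=> mA.
have mf : measurable_fun setT (fun x : MR => (x + a : MR)).
  by apply: measurable_funD => //; exact: measurable_cst.
apply/esym.
apply: (@lebesgue_measure_unique R (pushforward mu (fun x : MR => (x + a : MR)))) => //.
move=> _ [[b c]] _ <-; rewrite /pushforward.
transitivity (mu `](b - a), (c - a)]%classic).
  rewrite /= !lebesgue_measure_itv/= !lte_fin ltrD2r -!EFinB.
  by case: ifPn => // _; congr EFin; ring.
congr (mu _).
by apply/seteqP; split=> x /=; rewrite !in_itv/= => /andP[? ?]; apply/andP; split; lra.
Qed.

Lemma ge0_integral_translation (a : R) (f : MR -> \bar R) :
  measurable_fun setT f -> (forall x, 0 <= f x)%E ->
  (\int[mu]_x f (x + a)%R = \int[mu]_x f x)%E.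
Proof.
move=> mf f0.
have ma : measurable_fun setT (fun x : MR => (x + a : MR)).
  by apply: measurable_funD => //; exact: measurable_cst.
transitivity (\int[pushforward mu (fun x : MR => (x + a : MR)%R)]_x f x)%E.
  by rewrite ge0_integral_pushforward// => x _; exact: f0.
by apply: eq_measure_integral => //= A mA _; exact: lebesgue_measure_translation.
Qed.

(** The shear (y, z) |-> (y - k z, z) after the shear (y, w) |-> (y, w + m y).
    The lines with y fixed have direction (- k, 1), those with w fixed have
    direction (1 - k m, m). *)
Definition shear (k m : R) (p : MR * MR) : MR * MR :=
  (p.1 - k * (p.2 + m * p.1), p.2 + m * p.1).

Lemma continuous_linear2 (a b : R) : continuous (fun p : R * R => a * p.1 + b * p.2).
Proof.
move=> p; apply: cvgD; apply: cvgM; try exact: cvg_cst.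
  exact: cvg_fst.
exact: cvg_snd.
Qed.

(** Either shear translates one coordinate by an amount depending on the other, so
    integrating first in the translated coordinate shows the invariance. *)
Lemma ge0_integral_shear (k m : R) (f : MR * MR -> \bar R) :
  measurable_fun setT f -> (forall x, 0 <= f x)%E ->
  (\int[leb2 R]_x f x = \int[mu]_y \int[mu]_w f (shear k m (y, w)))%E.
Proof.
move=> mf f0.
pose g (p : MR * MR) := f (p.1 - k * p.2, p.2).
have mg : measurable_fun setT g.
  apply: (measurableT_comp mf); apply: measurable_fun_pair => /=; last exact: measurable_snd.
  apply: measurable_funB; first exact: measurable_fst.
  by apply: measurable_funM; [exact: measurable_cst|exact: measurable_snd].
have mg1 y : measurable_fun setT (fun z => g (y, z)).
  exact: measurableT_comp mg (measurable_pair1 y).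
transitivity (\int[mu]_z \int[mu]_x f (x, z))%E.
  by rewrite /leb2 fubini_tonelli2.
transitivity (\int[mu]_z \int[mu]_y g (y, z))%E.
  apply: eq_integral => z _.
  rewrite -(@ge0_integral_translation (- (k * z)) (fun x => f (x, z)))//.
  exact: measurableT_comp mf (measurable_pair2 z).
rewrite -fubini_tonelli//; last by move=> x; exact: f0.
apply: eq_integral => y _.
rewrite -(@ge0_integral_translation (m * y) (fun z => g (y, z)))//.
by move=> z; exact: f0.
Qed.

End PlaneMeasure.

(** * Inequalities on a segment *)

Section Segment.
Variable R : realType.
Local Notation mu := (@lebesgue_measure R).
Implicit Types (a b : R) (f g G H P Q : R -> R).

Lemma is_derive_continuous f (x d : R) : is_derive x (1 : R) f d -> {for x, continuous f}.
Proof.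
by move=> fx; apply: differentiable_continuous; exact/derivable1_diffP/ex_derive.
Qed.

Lemma continuous_integrable_segment a b f : continuous f ->
  mu.-integrable `[a, b] (EFin \o f).
Proof.
move=> cf; apply: continuous_compact_integrable; first exact: segment_compact.
exact: continuous_subspaceT.
Qed.

(** The fundamental theorem of calculus in the form used twice below: an
    inequality between integrals follows from a pointwise inequality between the
    integrands up to an exact derivative. *)
Lemma le_integral_derivative a b H dH Q P : a < b ->
  (forall x, x \in `[a, b] -> is_derive x 1 H (dH x)) ->
  (forall x, x \in `[a, b] -> {for x, continuous dH}) ->
  continuous Q -> continuous P ->
  (forall x, x \in `[a, b] -> dH x + Q x <= P x) ->
  ((H b - H a)%:E + \int[mu]_(x in `[a, b]) (Q x)%:E
     <= \int[mu]_(x in `[a, b]) (P x)%:E)%E.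
Proof.
move=> ab dHH cdH cQ cP HP.
have wdH : {within `[a, b], continuous dH}.
  by apply: continuous_in_subspaceT => x; rewrite inE; exact: cdH.
have cH x : x \in `[a, b] -> {for x, continuous H}.
  by move=> /dHH; exact: is_derive_continuous.
rewrite EFinB -(@continuous_FTC2 _ dH H a b)//; last 2 first.
- split.
  + move=> x xab; apply: ex_derive; apply: dHH.
    by apply: subset_itv_oo_cc xab.
  + apply: cvg_at_right_filter; apply: cH; by rewrite in_itv/= lexx ltW.
  + apply: cvg_at_left_filter; apply: cH; by rewrite in_itv/= lexx ltW.
- move=> x xab; rewrite derive1E; apply: derive_val; apply: dHH.
  by apply: subset_itv_oo_cc xab.
have idH : mu.-integrable `[a, b] (EFin \o dH).
  by apply: continuous_compact_integrable => //; exact: segment_compact.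
rewrite -integralD//=; last exact: continuous_integrable_segment.
apply: le_integral => //.
- apply: integrableD => //; exact: continuous_integrable_segment.
- exact: continuous_integrable_segment.
- by move=> x /[!inE] xab; rewrite lee_fin; exact: HP.
Qed.

Section C1.
Variables (G dG : R -> R).
Hypothesis dGG : forall x : R, is_derive x 1 G (dG x).
Hypothesis cdG : continuous dG.

Let cG : continuous G.
Proof. by move=> x; exact: is_derive_continuous (dGG x). Qed.

(** Integrate 0 <= (G' - c)^2 = G'^2 - (2 c G - c^2 x)', where c is the mean
    slope of G. *)
Lemma cauchy_schwarz_derivative a b : a < b ->
  (((G b - G a) ^+ 2)%:E <=
     (b - a)%:E * \int[mu]_(x in `[a, b]) (dG x ^+ 2)%:E)%E.
Proof.
move=> ab.
pose c := (G b - G a) / (b - a).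
have ba : 0 < b - a by lra.
have H x : is_derive x (1 : R) (fun x => 2 * c * G x - c ^+ 2 * x) (2 * c * dG x - c ^+ 2).
  change (is_derive x (1 : R) (cst (2 * c) * G - cst (c ^+ 2) * id)
    (2 * c * dG x - c ^+ 2)).
  by apply: is_derive_eq; rewrite /cst /= /GRing.scale/=; ring.
have := @le_integral_derivative a b _ _ (cst 0) (fun x => dG x ^+ 2) ab (fun x _ => H x).
rewrite integral0_eq ?adde0//.
have cdG2 : continuous (fun x => dG x ^+ 2).
  by move=> x; apply: cvgM; exact: cdG.
move=> LE; rewrite -lee_pdivrMl//; apply: (le_trans _ (LE _ _ _ _)) => //; last 3 first.
- by move=> x _; apply: cvgB; [apply: cvgM; [exact: cvg_cst|exact: cdG]|exact: cvg_cst].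
- by move=> x; exact: cvg_cst.
- by move=> x _; rewrite /cst addr0; have := sqr_ge0 (dG x - c); nra.
rewrite -EFinM lee_fin /c le_eqVlt; apply/orP; left; apply/eqP.
by field; rewrite gt_eqF.
Qed.

(** With T = tan (k (x - c)), c the midpoint, one has T' = k (1 + T^2), so
    G'^2 - k^2 G^2 = (G' + k T G)^2 - (k T G^2)'. The condition on k keeps the
    argument of the tangent away from its poles on the closed segment. *)
Lemma wirtinger_lt (k : R) a b : a < b -> 0 < k -> k * (b - a) < pi ->
  G a = 0 -> G b = 0 ->
  ((k ^+ 2)%:E * \int[mu]_(x in `[a, b]) (G x ^+ 2)%:E <=
     \int[mu]_(x in `[a, b]) (dG x ^+ 2)%:E)%E.
Proof.
move=> ab k0 kab Ga Gb.
pose c := (a + b) / 2.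
have cosN0 x : x \in `[a, b] -> cos (k * (x - c)) != 0.
  rewrite in_itv/= => /andP[ax xb]; rewrite gt_eqF// cos_gt0_pihalf//.
  by rewrite /c; nra.
pose T x := tan (k * (x - c)).
have dT x : x \in `[a, b] -> is_derive x (1 : R) T (k * (1 + T x ^+ 2)).
  move=> /cosN0 xN0; rewrite /T -cos2_tan2//.
  have dt := is_derive_tan xN0.
  have dl : is_derive x (1 : R) (cst k * (id - cst c)) k.
    by apply: is_derive_eq; rewrite /cst /= /GRing.scale/=; ring.
  by rewrite [k * _]mulrC; exact: (@is_derive1_comp _ tan (cst k * (id - cst c)) x _ _ dt dl).
have cT x : x \in `[a, b] -> {for x, continuous T}.
  by move=> /dT; exact: is_derive_continuous.
pose dH x := - (k ^+ 2 * (1 + T x ^+ 2) * G x ^+ 2) - 2 * k * T x * G x * dG x.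
have H x : x \in `[a, b] -> is_derive x (1 : R) (cst (- k) * T * G ^+ 2) (dH x).
  move=> /dT dTx.
  by apply: is_derive_eq; rewrite !fctE /dH /cst /= /GRing.scale/=; ring.
have := @le_integral_derivative a b _ _ (fun x => k ^+ 2 * G x ^+ 2)
  (fun x => dG x ^+ 2) ab H.
rewrite /= !fctE Ga Gb expr0n/= !mulr0 subrr add0e.
have c2 (f : R -> R) (x : R) : {for x, continuous f} -> {for x, continuous (fun x => f x ^+ 2)}.
  by move=> cf; apply: cvgM; exact: cf.
under eq_integral do rewrite EFinM.
rewrite ge0_integralZl_EFin ?sqr_ge0//; last 2 first.
- by move=> x _; rewrite lee_fin sqr_ge0.
- apply/measurable_EFinP; apply: measurable_funTS.
  by apply: continuous_measurable_fun => x; apply: c2; exact: cG.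
apply => //.
- move=> x /cT cTx; apply: cvgB.
    apply: cvgN; apply: cvgM; last by apply: c2; exact: cG.
    by apply: cvgM; [exact: cvg_cst|apply: cvgD; [exact: cvg_cst|exact: c2]].
  apply: cvgM; last exact: cdG.
  by apply: cvgM; [apply: cvgM; [exact: cvg_cst|]|exact: cG].
- by move=> x; apply: cvgM; [exact: cvg_cst|apply: c2; exact: cG].
- by move=> x; apply: c2; exact: cdG.
- by move=> x _; have := sqr_ge0 (dG x + k * T x * G x); rewrite /dH; nra.
Qed.

(** For the sharp constant the tangent has poles at both ends; it is obtained from
    the smaller constants by letting k tend to pi / (b - a). *)
Lemma wirtinger a b : a < b -> G a = 0 -> G b = 0 ->
  (((pi / (b - a)) ^+ 2)%:E * \int[mu]_(x in `[a, b]) (G x ^+ 2)%:E <=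
     \int[mu]_(x in `[a, b]) (dG x ^+ 2)%:E)%E.
Proof.
move=> ab Ga Gb.
have fin f : continuous f -> exists2 r, 0 <= r & (\int[mu]_(x in `[a, b]) (f x ^+ 2)%:E)%E = r%:E.
  move=> cf; exists (fine (\int[mu]_(x in `[a, b]) (f x ^+ 2)%:E)%E).
    by apply: fine_ge0; apply: integral_ge0 => x _; rewrite lee_fin sqr_ge0.
  rewrite fineK//; apply: integrable_fin_num => //; apply: continuous_integrable_segment.
  by move=> x; apply: cvgM; exact: cf.
have := @wirtinger_lt _ a b ab.
have [A A0 ->] := fin _ cG; have [B B0 ->] := fin _ cdG => W.
rewrite -EFinM lee_fin.
set K := pi / (b - a).
have K0 : 0 < K by rewrite divr_gt0 ?pi_gt0// subr_gt0.
(* If the sharp bound failed by a relative amount 4 t, then k = (1 - t) K would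
   violate the bound for smaller constants. *)
rewrite leNgt; apply/negP => BA.
have A1 : 0 < K ^+ 2 * A by apply: le_lt_trans BA.
have [t [t0 t1 tE]] : exists t : R,
    [/\ 0 < t, t <= 1 / 4 & 4 * (t * (K ^+ 2 * A)) = K ^+ 2 * A - B].
  move: (K ^+ 2 * A) A1 B0 BA => q q0 b0 Bq.
  have q4 : 0 < 4 * q by rewrite mulr_gt0.
  exists ((q - B) / (4 * q)); split.
  - by rewrite divr_gt0 ?subr_gt0.
  - by rewrite ler_pdivrMr//; lra.
  - by field; rewrite gt_eqF.
have := W (K * (1 - t)).
rewrite -EFinM lee_fin => /(_ _ _ Ga Gb) W'.
have t1' : 0 < 1 - t by lra.
have : (K * (1 - t)) ^+ 2 * A <= B.
  apply: W'; first exact: mulr_gt0.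
  have -> : K * (1 - t) * (b - a) = pi - pi * t.
    by rewrite /K; field; rewrite gt_eqF// subr_gt0.
  by rewrite ltrBlDr ltrDl mulr_gt0// pi_gt0.
have -> : (K * (1 - t)) ^+ 2 * A = (1 - t) ^+ 2 * (K ^+ 2 * A) by ring.
move: (K ^+ 2 * A) A1 BA tE {W W'} => q q0 Bq tE.
have : 0 <= t ^+ 2 * q by rewrite mulr_ge0 ?sqr_ge0// ltW.
have -> : (1 - t) ^+ 2 * q = q - 2 * (t * q) + t ^+ 2 * q by ring.
lra.
Qed.

End C1.
End Segment.

(** * Directional derivatives and test functions *)

Section Smooth.
Variable R : realType.
Implicit Types (f g phi psi : R * R -> R) (p v w : R * R).
Local Notation e1 := (e1 R).
Local Notation e2 := (e2 R).

Lemma is_derive_line phi p v (t : R) : derivable phi (p + t *: v) v ->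
  is_derive t (1 : R) (fun s => phi (p + s *: v)) ('D_v phi (p + t *: v)).
Proof.
move=> dphi.
have E : (fun h : R => h^-1 *: (((fun s => phi (p + s *: v)) \o shift t) (h *: (1 : R))
      - phi (p + t *: v)))
  = (fun h : R => h^-1 *: ((phi \o shift (p + t *: v)) (h *: v) - phi (p + t *: v))).
  apply/funext => h; rewrite /= /shift/=; congr (_ *: (phi _ - _)).
  by rewrite [h *: 1]mulr1 scalerDl addrCA.
by apply: DeriveDef; rewrite /derivable /derive E.
Qed.

Lemma Ck_derivable phi v p : Ck 1 phi -> derivable phi p v.
Proof. by move=> [_ /(_ v)[]]. Qed.

Lemma Ck_cont phi k : Ck k phi -> continuous phi.
Proof. by case: k => [|k] []. Qed.

Lemma Ck_cont_derive phi v : Ck 1 phi -> continuous ('D_v phi).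
Proof. by move=> [_ /(_ v)[_ []]]. Qed.

Lemma continuous_line p v : continuous (fun t : R => p + t *: v).
Proof.
by move=> t; apply: cvgD; [exact: cvg_cst|exact: scalel_continuous].
Qed.

Lemma deriveZv phi (k : R) v p : Ck 1 phi ->
  'D_(k *: v) phi p = k * 'D_v phi p.
Proof.
move=> Cphi.
pose g' (s : R) := phi (p + s *: v).
have g'D s : is_derive s (1 : R) g' ('D_v phi (p + s *: v)).
  by apply: is_derive_line; exact: Ck_derivable.
have dl : is_derive 0 (1 : R) (cst k * id) k.
  by apply: is_derive_eq; rewrite /cst /= /GRing.scale/=; ring.
have := @is_derive1_comp _ g' (cst k * id) 0 _ _ (g'D _) dl.
have := @is_derive_line phi p (k *: v) 0 (Ck_derivable Cphi).
have -> : g' \o (cst k * id) = (fun s => phi (p + s *: (k *: v))).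
  by apply/funext => s; rewrite /g' /= !fctE /cst/= scalerA [s * k]mulrC.
rewrite !fctE /cst /= mulr0 !scale0r !addr0 => -[_ <-] [_ ->].
by rewrite mulrC.
Qed.

(** Only directional derivatives are assumed to exist, so additivity in the direction
    is not automatic: the increment along w from the moving base point p + h v is
    h times a value of the derivative along w near p, by the mean value theorem,
    and that derivative is continuous. *)
Lemma deriveDv phi v w p : Ck 1 phi ->
  'D_(v + w) phi p = 'D_v phi p + 'D_w phi p.
Proof.
move=> Cphi.
have cW : continuous ('D_w phi) by exact: Ck_cont_derive.
pose q u (h : R) := h^-1 *: ((phi \o shift p) (h *: u) - phi p).
pose a (h : R) := q (v + w) h - q v h.
have qD u : q u @ 0^' --> 'D_u phi p by exact: Ck_derivable Cphi.
have aD : a @ 0^' --> 'D_(v + w) phi p - 'D_v phi p by apply: cvgB; exact: qD.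
suff aW : a @ 0^' --> 'D_w phi p.
  apply/eqP; rewrite [X in _ == X]addrC -subr_eq; apply/eqP.
  exact: (cvg_unique (@norm_hausdorff _ _) aD aW).
apply/cvgrPdist_lt => e e0.
have := cW p => /cvgrPdist_lt /(_ _ e0) /nbhs_ballP[d /= d0 bd].
pose M := `|v| + `|w| + 1.
have M0 : 0 < M by rewrite ltr_wpDl// addr_ge0.
near=> h.
have h0 : h != 0 by near: h; exact: nbhs_dnbhs_neq.
have hd : `|h| * M < d.
  rewrite -ltr_pdivlMr//; near: h; apply: dnbhs0_lt; exact: divr_gt0.
pose g (s : R) := phi ((p + h *: v) + s *: (h *: w)).
pose dg (s : R) := h * 'D_w phi ((p + h *: v) + s *: (h *: w)).
have gD s : is_derive s (1 : R) g (dg s).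
  by rewrite /dg -(deriveZv h w _ Cphi); apply: is_derive_line; exact: Ck_derivable.
have [|c cI] := @MVT R g dg 0 1 ltr01 (fun x _ => gD x).

- by apply: continuous_subspaceT => x; exact: is_derive_continuous (gD x).
rewrite subr0 mulr1 /g /dg scale1r scale0r addr0 => gE.
have -> : a h = 'D_w phi (p + h *: v + c *: (h *: w)).
  transitivity (h^-1 * (h * 'D_w phi (p + h *: v + c *: (h *: w)))).
    rewrite -gE /a /q /= /shift/= -scalerBr; congr (_ * _).
    rewrite scalerDr [_ + p]addrC addrA [h *: v + p]addrC.
    by ring.
  by rewrite mulrA mulVf// mul1r.
apply: bd; rewrite -ball_normE /=.
rewrite -addrA opprD addrA subrr add0r normrN.
apply: le_lt_trans hd; apply: (le_trans (ler_normD _ _)).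
rewrite !normrZ /M !mulrDr.
move: cI; rewrite in_itv/= => /andP[c0 c1].
have : `|c| * (`|h| * `|w|) <= `|h| * `|w|.
  by rewrite ler_piMl ?mulr_ge0// ger0_norm ?ltW.
by have := normr_ge0 h; lra.
Unshelve. all: by end_near. Qed.

Lemma derive_pair phi (a b : R) p : Ck 1 phi ->
  'D_((a, b)) phi p = a * 'D_e1 phi p + b * 'D_e2 phi p.
Proof.
move=> Cphi.
have -> : (a, b) = a *: e1 + b *: e2.
  by rewrite /e1 /e2; congr pair; rewrite /= /GRing.scale/= ?mulr0 ?mulr1 ?addr0 ?add0r.
by rewrite deriveDv// !deriveZv.
Qed.

Lemma CkD k f g : Ck k f -> Ck k g -> Ck k (f + g).
Proof.
elim: k f g => [|k IH] f g [cf Hf] [cg Hg]; split => //=.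
- by move=> x; apply: cvgD; [exact: cf|exact: cg].
- by move=> x; apply: cvgD; [exact: cf|exact: cg].
- move=> v; have [df Cf] := Hf v; have [dg Cg] := Hg v; split.
    by move=> x; exact: derivableD.
  have -> : 'D_v (f + g) = 'D_v f + 'D_v g by apply/funext => x; rewrite deriveD.
  exact: IH.
Qed.

Lemma CkZ k f (c : R) : Ck k f -> Ck k (c \*: f).
Proof.
elim: k f => [|k IH] f [cf Hf]; split => //=.
- by move=> x; apply: cvgZl_tmp; exact: cf.
- by move=> x; apply: cvgZl_tmp; exact: cf.
- move=> v; have [df Cf] := Hf v; split.
    by move=> x; exact: derivableZ.
  have -> : 'D_v (c \*: f) = c \*: 'D_v f by apply/funext => x; rewrite deriveZ.
  exact: IH.
Qed.

Lemma supp_out f x : ~ supp f x -> \forall y \near x, f y = 0.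
Proof.
move=> nfx.
have : open (~` supp f) by apply: closed_openC; exact: closed_closure.
rewrite openE => /(_ _ nfx); apply: filterS => y nfy.
by apply: contrapT => /eqP fy; apply: nfy; exact: subset_closure.
Qed.

Lemma supp0 f x : ~ supp f x -> f x = 0.
Proof. by move=> /supp_out /nbhs_singleton. Qed.

Lemma derive_supp0 f v x : ~ supp f x -> 'D_v f x = 0.
Proof.
move=> /supp_out fx; rewrite (@near_eq_derive _ _ _ _ (cst 0))//.
exact: derive_cst.
Qed.

Lemma supp_derive f v : supp ('D_v f) `<=` supp f.
Proof.
rewrite [X in _ `<=` X](closure_id _).1; last exact: closed_closure.
apply: closureS => x /= /eqP; apply: contra_notP; exact: derive_supp0.
Qed.

Lemma test_derive Omega phi v : test_function Omega phi ->
  test_function Omega ('D_v phi).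
Proof.
move=> [C K S]; split.
- by move=> k; have [_ /(_ v)[]] := C k.+1.
- apply: subclosed_compact K _; last exact: supp_derive.
  exact: closed_closure.
- by move=> x /supp_derive /S.
Qed.

Lemma testD Omega f g : test_function Omega f -> test_function Omega g ->
  test_function Omega (f + g).
Proof.
move=> [Cf Kf Sf] [Cg Kg Sg].
have sub : supp (f + g) `<=` supp f `|` supp g.
  rewrite /supp -closureU; apply: closureS => x /= /eqP fgx.
  apply: contrapT => /not_orP[/negP/negPn/eqP fx /negP/negPn/eqP gx].
  by apply: fgx; rewrite !fctE fx gx addr0.
split; first by move=> k; exact: CkD.
- apply: subclosed_compact sub; first exact: closed_closure.
  exact: compactU.
- by move=> x /sub[/Sf|/Sg].
Qed.

Lemma testZ Omega f (c : R) : test_function Omega f ->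
  test_function Omega (c \*: f).
Proof.
move=> [Cf Kf Sf].
have sub : supp (c \*: f) `<=` supp f.
  apply: closureS => x /= /eqP fx; apply/eqP => f0; apply: fx.
  by rewrite f0 scaler0.
split; first by move=> k; exact: CkZ.
- by apply: subclosed_compact sub => //; exact: closed_closure.
- by move=> x /sub/Sf.
Qed.

End Smooth.

(** * Sheared coordinates *)

Section Rectangle.
Variable R : realType.
Local Notation mu := (@lebesgue_measure R).
Local Notation MR := (measurableTypeR R).
Variables (g : R * R -> R).
Hypotheses (cg : continuous g) (g0 : forall p, 0 <= g p).

Let rg (I J : set R) : MR * MR -> \bar R := (EFin \o g) \_ (I `*` J).

Let rg0 I J p : (0 <= rg I J p)%E.
Proof. by rewrite /rg patchE; case: ifPn => // _; rewrite lee_fin. Qed.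

Let mrg (I J : set MR) : measurable I -> measurable J -> measurable_fun setT (rg I J).
Proof.
move=> mI mJ; apply/(measurable_restrictT _ _).1; first exact: measurableX.
by apply: measurable_funTS; apply/measurable_EFinP; exact: continuous2_measurable.
Qed.

Let rgE1 (I J : set MR) y : (\int[mu]_w rg I J (y, w))%E =
  ((fun y => \int[mu]_(w in J) (g (y, w))%:E) \_ I)%E y.
Proof.
rewrite patchE; case: ifPn => yI.
  rewrite [RHS]integral_mkcond; apply: eq_integral => w _.
  by rewrite /rg !patchE in_setX/= yI.
by rewrite integral0_eq// => w _; rewrite /rg patchE in_setX/= (negbTE yI).
Qed.

Let rgE2 (I J : set MR) w : (\int[mu]_y rg I J (y, w))%E =
  ((fun w => \int[mu]_(y in I) (g (y, w))%:E) \_ J)%E w.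
Proof.
rewrite patchE; case: ifPn => wJ.
  rewrite [RHS]integral_mkcond; apply: eq_integral => y _.
  by rewrite /rg !patchE in_setX/= wJ andbT.
by rewrite integral0_eq// => y _; rewrite /rg patchE in_setX/= (negbTE wJ) andbF.
Qed.

Lemma measurable_inner1 (J : set MR) : measurable J ->
  measurable_fun setT (fun y : MR => \int[mu]_(w in J) (g (y, w))%:E)%E.
Proof.
move=> mJ.
rewrite (_ : (fun y => _) = (fun y => \int[mu]_w rg setT J (y, w)))%E.
  by apply: measurable_fun_fubini_tonelli_F; [exact: mrg|exact: rg0].
by apply/funext => y; rewrite rgE1 patchE in_setT.
Qed.

Lemma measurable_inner2 (I : set MR) : measurable I ->
  measurable_fun setT (fun w : MR => \int[mu]_(y in I) (g (y, w))%:E)%E.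
Proof.
move=> mI.
rewrite (_ : (fun y => _) = (fun w => \int[mu]_y rg I setT (y, w)))%E.
  by apply: measurable_fun_fubini_tonelli_G; [exact: mrg|exact: rg0].
by apply/funext => y; rewrite rgE2 patchE in_setT.
Qed.

Lemma integral_rect_swap (I J : set MR) : measurable I -> measurable J ->
  (\int[mu]_(y in I) \int[mu]_(w in J) (g (y, w))%:E =
   \int[mu]_(w in J) \int[mu]_(y in I) (g (y, w))%:E)%E.
Proof.
move=> mI mJ; rewrite integral_mkcond [RHS]integral_mkcond.
transitivity (\int[mu]_y \int[mu]_w rg I J (y, w))%E.
  by apply: eq_integral => y _; rewrite rgE1.
rewrite fubini_tonelli//; last exact: mrg.
by apply: eq_integral => w _; rewrite rgE2.
Qed.

End Rectangle.

Section Shear.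
Variable R : realType.
Local Notation mu := (@lebesgue_measure R).
Local Notation MR := (measurableTypeR R).
Variables (k m : R).

Definition unshear (x : R * R) : R * R :=
  (x.1 + k * x.2, x.2 - m * (x.1 + k * x.2)).

Lemma shearK : cancel (shear k m) unshear.
Proof. by case=> y w; rewrite /shear /unshear /=; congr pair; ring. Qed.

Lemma shear_line1 y w : shear k m (y, w) = (- (k * w), w) + y *: (1 - k * m, m).
Proof. by rewrite /shear /=; congr pair; rewrite /= /GRing.scale/=; ring. Qed.

Lemma shear_line2 y w :
  shear k m (y, w) = (y - k * (m * y), m * y) + w *: (- k, 1).
Proof. by rewrite /shear /=; congr pair; rewrite /= /GRing.scale/=; ring. Qed.

Lemma continuous_pair2 (f g : R * R -> R) : continuous f -> continuous g ->
  continuous (fun x => (f x, g x)).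
Proof. by move=> cf cg x; exact: (cvg_pair (cf x) (cg x)). Qed.

Lemma continuous_shear : continuous (shear k m : R * R -> R * R).
Proof.
rewrite (_ : shear k m = (fun p : R * R => ((1 - k * m) * p.1 + (- k) * p.2, m * p.1 + 1 * p.2))).
  by apply: continuous_pair2; exact: continuous_linear2.
by apply/funext => -[y w]; rewrite /shear /=; congr pair; ring.
Qed.

Lemma measurable_unshear : measurable_fun setT (unshear : MR * MR -> MR * MR).
Proof.
rewrite (_ : unshear = (fun p : R * R => (1 * p.1 + k * p.2, (- m) * p.1 + (1 - m * k) * p.2))).
  by apply: measurable_fun_pair; apply: continuous2_measurable; exact: continuous_linear2.
by apply/funext => -[y w]; rewrite /unshear /=; congr pair; ring.
Qed.

Definition cell (I J : set R) : set (R * R) := unshear @^-1` (I `*` J).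

Lemma mem_cell (I J : set R) y w :
  (shear k m (y, w) \in cell I J) = (y \in I) && (w \in J).
Proof.
have <- : ((y, w) \in I `*` J) = (y \in I) && (w \in J) by rewrite in_setX.
apply/idP/idP; rewrite !inE => H.
  by rewrite -(shearK (y, w)).
by rewrite /cell /preimage /mkset shearK.
Qed.

Lemma measurable_cell (I J : set MR) : measurable I -> measurable J ->
  measurable (cell I J : set (MR * MR)).
Proof.
move=> mI mJ; rewrite -[cell I J]setTI.
by apply: measurable_unshear => //; exact: measurableX.
Qed.

Lemma ge0_integral_cell (f : R * R -> R) (I J : set MR) :
  continuous f -> (forall p, 0 <= f p) -> measurable I -> measurable J ->
  (\int[leb2 R]_(x in cell I J) (f x)%:E =
   \int[mu]_(y in I) \int[mu]_(w in J) (f (shear k m (y, w)))%:E)%E.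
Proof.
move=> cf f0 mI mJ.
have mc := measurable_cell mI mJ.
rewrite integral_mkcond (ge0_integral_shear k m); last 2 first.
- apply/(measurable_restrictT _ _).1 => //.
  by apply: measurable_funTS; apply/measurable_EFinP; exact: continuous2_measurable.
- by move=> x; rewrite patchE; case: ifPn => // _; rewrite lee_fin.
rewrite [RHS]integral_mkcond; apply: eq_integral => y _.
rewrite patchE; case: ifPn => yI; last first.
  by apply: integral0_eq => w _; rewrite patchE mem_cell (negbTE yI).
rewrite [RHS]integral_mkcond; apply: eq_integral => w _.
by rewrite !patchE mem_cell yI.
Qed.

End Shear.

(** * The Poincare inequality on a parallelogram *)

Section Oscillation.
Variable R : realType.
Local Notation mu := (@lebesgue_measure R).

Lemma continuous_sqr (T : topologicalType) (f : T -> R) :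
  continuous f -> continuous (fun x => f x ^+ 2).
Proof. by move=> cf x; apply: cvgM; exact: cf. Qed.

Lemma oscillation_le (G dG : R -> R) a b x y :
  (forall x : R, is_derive x (1 : R) G (dG x)) -> continuous dG ->
  x \in `[a, b] -> y \in `[a, b] ->
  (((G x - G y) ^+ 2)%:E <=
     (b - a)%:E * \int[mu]_(s in `[a, b]) (dG s ^+ 2)%:E)%E.
Proof.
move=> dGG cdG.
wlog xy : x y / x < y => [H xab yab|].
  have [xy|yx|->] := ltgtP x y; first exact: H.
    by rewrite -sqrrN opprB; exact: H.
  rewrite subrr expr0n/= mule_ge0//.
    by move: yab; rewrite in_itv/= lee_fin => /andP[? ?]; lra.
  by apply: integral_ge0 => s _; rewrite lee_fin sqr_ge0.
rewrite !in_itv/= => /andP[ax xb] /andP[ay yb].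
rewrite -sqrrN opprB; apply: le_trans (cauchy_schwarz_derivative dGG cdG xy) _.
apply: lee_pmul.
- by rewrite lee_fin; lra.
- by apply: integral_ge0 => s _; rewrite lee_fin sqr_ge0.
- by rewrite lee_fin; lra.
apply: ge0_subset_integral => //.
- apply/measurable_EFinP; apply: measurable_funTS; apply: continuous_measurable_fun.
  exact: continuous_sqr.
- by move=> s _; rewrite lee_fin sqr_ge0.
- by move=> s /=; rewrite !in_itv/= => /andP[? ?]; apply/andP; split; lra.
Qed.

End Oscillation.

Lemma continuous_comp_line (R : realType) (f : R * R -> R) p v :
  continuous f -> continuous (fun s : R => f (p + s *: v)).
Proof.
move=> cf s; apply: (@continuous_comp _ _ _ (fun s : R => p + s *: v) f); last exact: cf.
exact: continuous_line.
Qed.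

Lemma ge0_integral_affine d (T : measurableType d) (R : realType)
    (mu : {measure set T -> \bar R}) (D : set T) (A : T -> \bar R) (c : R)
    (e r : \bar R) : measurable D -> mu D = r -> measurable_fun D A ->
  (forall x, 0 <= A x)%E -> 0 <= c -> (0 <= e)%E ->
  (\int[mu]_(x in D) (c%:E * A x + e) = c%:E * \int[mu]_(x in D) A x + e * r)%E.
Proof.
move=> mD <- mA A0 c0 e0; rewrite ge0_integralD//.
- by rewrite ge0_integralZl_EFin// (integral_cst mu mD e).
- by move=> x _; rewrite mule_ge0.
- exact: measurable_funeM.
Qed.

Lemma lee_double_sum (R : realType) (h : R) (x y p q : \bar R) :
  (p <= h%:E * x -> q <= h%:E * y ->
   2%:E * p + 2%:E * q <= (2 * h)%:E * x + (2 * h)%:E * y)%E.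
Proof.
move=> px qy; rewrite EFinM -!muleA.
have two0 : (0 <= 2%:E :> \bar R)%E by rewrite lee_fin.
by apply: leeD; exact: lee_wpmul2l.
Qed.

(** The parallelogram Q with (y, w)-coordinates in ]a, a + h] x [b, b + h[. In
    these coordinates it is a square, and G1, G2 are the squares of the two partial
    derivatives. The half-open sides make a grid of such cells a partition. *)
Section CellPoincare.
Variable R : realType.
Local Notation mu := (@lebesgue_measure R).
Local Notation MR := (measurableTypeR R).
Variables (k m a b h : R) (phi : R * R -> R).
Hypotheses (h0 : 0 < h) (Cphi : Ck 1 phi).

Let I : set MR := `]a, (a + h)].
Let J : set MR := `[b, (b + h)[.
Let Q : set (R * R) := cell k m I J.
Let v1 : R * R := (1 - k * m, m).
Let v2 : R * R := (- k, 1).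
Let G1 x := 'D_v1 phi x ^+ 2.
Let G2 x := 'D_v2 phi x ^+ 2.
Let S := shear k m.

Let mI : measurable I. Proof. exact: measurable_itv. Qed.
Let mJ : measurable J. Proof. exact: measurable_itv. Qed.
Let mQ : measurable (Q : set (MR * MR)). Proof. exact: measurable_cell. Qed.
Let cphi : continuous phi. Proof. exact: Ck_cont Cphi. Qed.
Let cG1 : continuous G1. Proof. by apply: continuous_sqr; exact: Ck_cont_derive. Qed.
Let cG2 : continuous G2. Proof. by apply: continuous_sqr; exact: Ck_cont_derive. Qed.
Let G10 x : 0 <= G1 x. Proof. exact: sqr_ge0. Qed.
Let G20 x : 0 <= G2 x. Proof. exact: sqr_ge0. Qed.
Let muI : mu I = h%:E.
Proof. by rewrite /I lebesgue_measure_itv/= lte_fin ltrDl h0 -EFinB addrAC subrr add0r. Qed.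
Let muJ : mu J = h%:E.
Proof. by rewrite /J lebesgue_measure_itv/= lte_fin ltrDl h0 -EFinB addrAC subrr add0r. Qed.

Let cS f : continuous f -> continuous (fun p : R * R => f (S p) : R).
Proof. by move=> cf p; apply: continuous_comp; [exact: continuous_shear|exact: cf]. Qed.

Let A w := (\int[mu]_(s in I) (G1 (S (s, w)))%:E)%E.
Let B y := (\int[mu]_(s in J) (G2 (S (y, s)))%:E)%E.

Lemma measure_cell : leb2 R Q = (h * h)%:E.
Proof.
transitivity (\int[leb2 R]_(x in Q) (cst 1 x)%:E)%E.
  by rewrite (integral_cst _ mQ 1%:E) mul1e.
rewrite (@ge0_integral_cell _ k m (cst 1))//; last by move=> x; exact: cvg_cst.
transitivity (\int[mu]_(y in I) (cst h y)%:E)%E.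
  by apply: eq_integral => y _; rewrite (integral_cst mu mJ 1%:E) mul1e.
by rewrite (integral_cst mu mI h%:E) EFinM; congr (_ * _)%E; exact: muI.
Qed.

Let intQ1 : (\int[mu]_(w in J) A w = \int[leb2 R]_(x in Q) (G1 x)%:E)%E.
Proof.
rewrite (ge0_integral_cell k m cG1 G10 mI mJ).
by rewrite (integral_rect_swap (cS cG1) (fun p => G10 (S p)) mI mJ).
Qed.

Let intQ2 : (\int[mu]_(y in I) B y = \int[leb2 R]_(x in Q) (G2 x)%:E)%E.
Proof. by rewrite ge0_integral_cell. Qed.

Let mA : measurable_fun setT A.
Proof. exact: (measurable_inner2 (cS cG1) (fun p => G10 (S p)) mI). Qed.
Let mB : measurable_fun setT B.
Proof. exact: (measurable_inner1 (cS cG2) (fun p => G20 (S p)) mJ). Qed.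
Let A0 w : (0 <= A w)%E.
Proof. by rewrite /A; apply: integral_ge0 => s _; rewrite lee_fin. Qed.
Let B0 w : (0 <= B w)%E.
Proof. by rewrite /B; apply: integral_ge0 => s _; rewrite lee_fin. Qed.

Let mcA c : measurable_fun J (fun w => c * A w)%E.
Proof. exact: (measurable_funTS (measurable_funeM c mA)). Qed.
Let mcB c : measurable_fun I (fun w => c * B w)%E.
Proof. exact: (measurable_funTS (measurable_funeM c mB)). Qed.
Let cB0 c w : 0 <= c -> (0 <= c%:E * B w)%E.
Proof. by move=> c0; exact: mule_ge0 (B0 w). Qed.

Let osc1 y y' w : I y -> I y' ->
  (((phi (S (y, w)) - phi (S (y', w))) ^+ 2)%:E <= h%:E * A w)%E.
Proof.
rewrite /I /= !in_itv/= => Iy Iy'.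
pose G s := phi (S (s, w)).
pose dG s := 'D_v1 phi (S (s, w)).
have dGG (s : R) : is_derive s (1 : R) G (dG s).
  rewrite /G /dG /S shear_line1.
  under [X in is_derive _ _ X]funext do rewrite shear_line1.
  by apply: is_derive_line; exact: Ck_derivable.
have cdG : continuous dG.
  rewrite /dG /S; under [X in continuous X]funext do rewrite shear_line1.
  by apply: (continuous_comp_line (f := 'D_v1 phi)); exact: Ck_cont_derive.
have := @oscillation_le _ G dG a (a + h) y y' dGG cdG.
rewrite addrAC subrr add0r !in_itv/= => /(_ _ _)/le_trans; apply.
- by apply/andP; split; lra.
- by apply/andP; split; lra.
rewrite lee_pmul2l// /A /I integral_itv_obnd_cbnd//.
apply/measurable_EFinP; apply: measurable_funTS; apply: continuous_measurable_fun.
exact: continuous_sqr.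
Qed.

Let osc2 y w w' : J w -> J w' ->
  (((phi (S (y, w)) - phi (S (y, w'))) ^+ 2)%:E <= h%:E * B y)%E.
Proof.
rewrite /J /= !in_itv/= => Jw Jw'.
pose G s := phi (S (y, s)).
pose dG s := 'D_v2 phi (S (y, s)).
have dGG (s : R) : is_derive s (1 : R) G (dG s).
  rewrite /G /dG /S shear_line2.
  under [X in is_derive _ _ X]funext do rewrite shear_line2.
  by apply: is_derive_line; exact: Ck_derivable.
have cdG : continuous dG.
  rewrite /dG /S; under [X in continuous X]funext do rewrite shear_line2.
  by apply: (continuous_comp_line (f := 'D_v2 phi)); exact: Ck_cont_derive.
have := @oscillation_le _ G dG b (b + h) w w' dGG cdG.
rewrite addrAC subrr add0r !in_itv/= => /(_ _ _)/le_trans; apply.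
- by apply/andP; split; lra.
- by apply/andP; split; lra.
rewrite lee_pmul2l// /B /J integral_itv_bndo_bndc//.
apply/measurable_EFinP; apply: measurable_funTS; apply: continuous_measurable_fun.
exact: continuous_sqr.
Qed.

Let integral_cstI K : (\int[mu]_(y in I) (cst K y) = K * h%:E)%E.
Proof. by rewrite (integral_cst mu mI K); congr (_ * _)%E; exact: muI. Qed.

(** Two points of the square are joined by a segment along y followed by a segment
    along w. When the second endpoint is kept fixed at (y', b), the second segment
    lies on the line of abscissa y', whence the term B y'. *)
Let poincare_center y' : I y' ->
  (\int[leb2 R]_(x in Q) ((phi x - phi (S (y', b))) ^+ 2)%:E <=
   (2 * h ^+ 2)%:E * \int[leb2 R]_(x in Q) (G1 x)%:E +
   (2 * h ^+ 3)%:E * B y')%E.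
Proof.
move=> Iy'; set c := phi _.
have h2 : 0 <= 2 * h by rewrite mulr_ge0// ltW.
have Jb : J b by rewrite /J /= in_itv/= lexx ltrDl.
pose f x := (phi x - c) ^+ 2.
have cf : continuous f.
  by apply: continuous_sqr => x; apply: cvgB; [exact: cphi|exact: cvg_cst].
have f0 x : 0 <= f x by exact: sqr_ge0.
have cfy y : continuous (fun w : R => f (S (y, w))).
  rewrite /S; under [X in continuous X]funext do rewrite shear_line2.
  exact: continuous_comp_line.
rewrite (ge0_integral_cell k m cf f0 mI mJ).
pose K := ((2 * h)%:E * \int[leb2 R]_(x in Q) (G1 x)%:E + (2 * h)%:E * B y' * h%:E)%E.
apply: (@le_trans _ _ (\int[mu]_(y in I) (cst K y))%E).
  apply: ge0_le_integral => //.
  - by move=> y _; apply: integral_ge0 => w _; rewrite lee_fin.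
  - by apply: measurable_funTS; exact: (measurable_inner1 (cS cf) (fun p => f0 (S p)) mJ).
  move=> y Iy; rewrite /cst /K -intQ1.
  have <- : (\int[mu]_(w in J) ((2 * h)%:E * A w + (2 * h)%:E * B y') =
     (2 * h)%:E * \int[mu]_(w in J) A w + (2 * h)%:E * B y' * h%:E)%E.
    rewrite (@ge0_integral_affine _ _ _ mu J A (2 * h) _ _ mJ muJ (measurable_funTS mA) A0 h2)//.
    exact: cB0.
  apply: ge0_le_integral => //.
  - by move=> w _; rewrite lee_fin.
  - apply/measurable_EFinP; apply: measurable_funTS; apply: continuous_measurable_fun => w.
    exact: cfy.
  - by apply: emeasurable_funD; [exact: mcA|exact: measurable_cst].
  move=> w Jw; rewrite /f /c.
  apply: (@le_trans _ _ (2%:E * ((phi (S (y, w)) - phi (S (y', w))) ^+ 2)%:E +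
     2%:E * ((phi (S (y', w)) - phi (S (y', b))) ^+ 2)%:E)%E).
    rewrite -!EFinM -EFinD lee_fin.
    move: (phi (S (y, w))) (phi (S (y', w))) (phi (S (y', b))) => p q r.
    by have := sqr_ge0 (p - q - (q - r)); nra.
  by apply: lee_double_sum; [exact: osc1|exact: osc2].
rewrite (integral_cstI K) /K.
have : (0 <= \int[leb2 R]_(x in Q) (G1 x)%:E)%E.
  by apply: integral_ge0 => x _; rewrite lee_fin.
have := B0 y'.
move: (\int[leb2 R]_(x in Q) (G1 x)%:E)%E (B y') => u v v0 u0.
have h0' := ltW h0.
rewrite ge0_muleDl ?mule_ge0// muleAC -EFinM -!muleA -!EFinM [(v * _)%E]muleC muleA -EFinM.
by rewrite le_eqVlt; apply/orP; left; apply/eqP; congr (_%:E * _ + _%:E * _)%E; ring.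
Qed.

Hypothesis bphi : exists M, forall x, `|phi x| <= M.

Let integrable_bounded (f : R * R -> R) (M : R) : continuous f ->
  (forall x, `|f x| <= M) -> (leb2 R).-integrable Q (EFin \o f).
Proof.
move=> cf fM; apply: measurable_bounded_integrable => //.
- by rewrite measure_cell ltry.
- by apply: measurable_funTS; exact: continuous2_measurable.
- exists M; split; first exact: num_real.
  by move=> N MN x _; exact: le_trans (fM x) (ltW MN).
Qed.

(** The mean minimizes the quadratic deviation, so any constant c can replace it. *)
Let variance_le c :
  (\int[leb2 R]_(x in Q) (phi x ^+ 2)%:E <=
   \int[leb2 R]_(x in Q) ((phi x - c) ^+ 2)%:E +
   ((int2 Q phi / h) ^+ 2)%:E)%E.
Proof.
have [M phiM] := bphi.
have i1 := integrable_bounded cphi phiM.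
have c2 := continuous_sqr cphi.
have i2 : (leb2 R).-integrable Q (EFin \o (fun x => phi x ^+ 2)).
  apply: (integrable_bounded (M := M ^+ 2)) => // x.
  by rewrite normrX ler_sqr ?nnegrE// (le_trans _ (phiM x)).
have i0 : (leb2 R).-integrable Q (EFin \o (cst (c ^+ 2))).
  apply: (integrable_bounded (M := c ^+ 2)) => [x|x]; first exact: cvg_cst.
  by rewrite ger0_norm ?sqr_ge0.
have E : (\int[leb2 R]_(x in Q) ((phi x - c) ^+ 2)%:E =
  \int[leb2 R]_(x in Q) (phi x ^+ 2)%:E + (- (2 * c) * int2 Q phi + c ^+ 2 * (h * h))%:E)%E.
  have -> : (\int[leb2 R]_(x in Q) ((phi x - c) ^+ 2)%:E =
    \int[leb2 R]_(x in Q) ((phi x ^+ 2)%:E + ((- (2 * c))%:E * (phi x)%:E + (c ^+ 2)%:E)))%E.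
    by apply: eq_integral => x _; rewrite -EFinM -!EFinD; congr EFin; ring.
  have i1' : (leb2 R).-integrable Q (fun x => (- (2 * c))%:E * (phi x)%:E)%E.
    exact: integrableZl.
  rewrite integralD//=; last exact: integrableD.
  rewrite integralD// integralZl// (integral_cst _ mQ (c ^+ 2)%:E).
  congr (_ + _)%E; rewrite EFinD !EFinM; congr (_ * _ + _)%E.
    by rewrite /int2 /Rintegral fineK//; exact: integrable_fin_num.
  by rewrite -EFinM; congr (_ * _)%E; exact: measure_cell.
rewrite E -addeA -EFinD leeDl// lee_fin.
have -> : - (2 * c) * int2 Q phi + c ^+ 2 * (h * h) + (int2 Q phi / h) ^+ 2 =
   (c * h - int2 Q phi / h) ^+ 2 by field; rewrite gt_eqF.
exact: sqr_ge0.
Qed.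

(** The left-hand side does not depend on the abscissa y' of the reference point:
    average [poincare_center] over y' to turn B y' into an integral over Q. *)
Lemma poincare_cell :
  (\int[leb2 R]_(x in Q) (phi x ^+ 2)%:E <=
   (2 * h ^+ 2)%:E * (\int[leb2 R]_(x in Q) ('D_v1 phi x ^+ 2)%:E +
                      \int[leb2 R]_(x in Q) ('D_v2 phi x ^+ 2)%:E) +
   ((int2 Q phi / h) ^+ 2)%:E)%E.
Proof.
pose X := (\int[leb2 R]_(x in Q) (phi x ^+ 2)%:E)%E.
pose Y1 := (\int[leb2 R]_(x in Q) (G1 x)%:E)%E.
pose Y2 := (\int[leb2 R]_(x in Q) (G2 x)%:E)%E.
pose Z := ((int2 Q phi / h) ^+ 2)%:E.
change (X <= (2 * h ^+ 2)%:E * (Y1 + Y2) + Z)%E.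
have Y10 : (0 <= Y1)%E by apply: integral_ge0 => x _; rewrite lee_fin.
have Y20 : (0 <= Y2)%E by rewrite /Y2; apply: integral_ge0 => x _; rewrite lee_fin.
have Z0 : (0 <= Z)%E by rewrite lee_fin sqr_ge0.
have h2 : 0 <= 2 * h ^+ 2 by rewrite mulr_ge0 ?sqr_ge0.
have h3 : 0 <= 2 * h ^+ 3 by rewrite mulr_ge0// exprn_ge0// ltW.
rewrite -(@lee_pmul2l _ h%:E)// muleC.
rewrite -(integral_cstI X).
apply: (@le_trans _ _ (\int[mu]_(y in I) ((2 * h ^+ 3)%:E * B y + ((2 * h ^+ 2)%:E * Y1 + Z)))%E).
  apply: ge0_le_integral => //.
  - by move=> y _; apply: integral_ge0 => x _; rewrite lee_fin sqr_ge0.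
  - by apply: emeasurable_funD; [exact: mcB|exact: measurable_cst].
  move=> y Iy; apply: le_trans (variance_le (phi (S (y, b)))) _.
  by rewrite addeA; apply: leeD2r; rewrite [leRHS]addeC; exact: poincare_center.
have c0 : (0 <= (2 * h ^+ 2)%:E * Y1 + Z)%E.
  apply: (adde_ge0 _ Z0); apply: (mule_ge0 _ Y10); exact: h2.
have := @ge0_integral_affine _ _ _ mu I B (2 * h ^+ 3) _ _ mI muI (measurable_funTS mB) B0 h3 c0.
rewrite intQ2 -/Y2 => ->.
move: Y1 Y2 Z Y10 Y20 Z0 {c0} => u v z u0 v0 z0.
have h0' := ltW h0.
have hu : (0 <= (2 * h ^+ 2)%:E * u)%E by exact: mule_ge0.
have hv : (0 <= (2 * h ^+ 2)%:E * v)%E by exact: mule_ge0.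
rewrite (ge0_muleDl _ hu z0) (ge0_muleDr _ u0 v0) (ge0_muleDr _ (adde_ge0 hu hv) z0).
rewrite (ge0_muleDr _ hu hv).
rewrite addeA [((2 * h ^+ 3)%:E * v + _)%E]addeC.
rewrite ![(_ * h%:E)%E]muleC !muleA -!EFinM.
by rewrite le_eqVlt; apply/orP; left; apply/eqP; congr (_%:E * _ + _%:E * _ + _)%E; ring.
Qed.

End CellPoincare.

(** * The Wirtinger inequality along slices *)

(** Every slice of the cell at fixed y contains a segment of length L outside of
    which phi vanishes. *)
Section WirtingerCell.
Variable R : realType.
Local Notation mu := (@lebesgue_measure R).
Local Notation MR := (measurableTypeR R).
Variables (k m L : R) (I J : set MR) (phi : R * R -> R).
Hypotheses (L0 : 0 < L) (Cphi : Ck 1 phi) (mI : measurable I) (mJ : measurable J).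
Let v : R * R := (- k, 1).
Hypothesis slices : forall y, I y -> exists a, `[a, a + L]%classic `<=` J /\
  forall w, J w -> ~~ (a < w < a + L) -> phi (shear k m (y, w)) = 0.

Let f x := phi x ^+ 2.
Let g x := 'D_v phi x ^+ 2.
Let cf : continuous f. Proof. by apply: continuous_sqr; exact: Ck_cont Cphi. Qed.
Let cg : continuous g. Proof. by apply: continuous_sqr; exact: Ck_cont_derive. Qed.
Let f0 x : 0 <= f x. Proof. exact: sqr_ge0. Qed.
Let g0 x : 0 <= g x. Proof. exact: sqr_ge0. Qed.
Let cS (F : R * R -> R) : continuous F -> continuous (fun p : R * R => F (shear k m p) : R).
Proof.
move=> cF p; apply: (@continuous_comp _ _ _ (shear k m) F); last exact: cF.
exact: continuous_shear.
Qed.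

Let slice y : I y ->
  (((pi / L) ^+ 2)%:E * \int[mu]_(w in J) (f (shear k m (y, w)))%:E <=
   \int[mu]_(w in J) (g (shear k m (y, w)))%:E)%E.
Proof.
move=> /slices[a [aJ phi0]].
pose G s := phi (shear k m (y, s)).
pose dG s := 'D_v phi (shear k m (y, s)).
have aaL : a < a + L by rewrite ltrDl.
have dGG (s : R) : is_derive s (1 : R) G (dG s).
  rewrite /G /dG shear_line2.
  under [X in is_derive _ _ X]funext do rewrite shear_line2.
  by apply: is_derive_line; exact: Ck_derivable.
have cdG : continuous dG.
  rewrite /dG; under [X in continuous X]funext do rewrite shear_line2.
  by apply: (continuous_comp_line (f := 'D_v phi)); exact: Ck_cont_derive.
have Ga : G a = 0.
  by apply: phi0; [apply: aJ; rewrite /= in_itv/= lexx ltW|rewrite ltxx].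
have GL : G (a + L) = 0.
  by apply: phi0; [apply: aJ; rewrite /= in_itv/= lexx ltW|rewrite ltxx andbF].
have := wirtinger dGG cdG aaL Ga GL.
rewrite [a + L - a]addrAC subrr add0r => W.
have -> : (\int[mu]_(w in J) (f (shear k m (y, w)))%:E =
           \int[mu]_(w in `[a, (a + L)%R]) (G w ^+ 2)%:E)%E.
  rewrite integral_mkcond [RHS]integral_mkcond; apply: eq_integral => w _.
  rewrite !patchE.
  have [wJ|wJ] := boolP (w \in J); have [waL|waL] := boolP (w \in `[a, (a + L)%R]%classic) => //.
    rewrite /f phi0 ?expr0n//; first by rewrite inE in wJ.
    by apply: contra waL => /andP[aw wa]; rewrite inE/= in_itv/= !ltW.
  by move: wJ waL; rewrite notin_setE inE => wJ /aJ.
apply: (le_trans W).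
apply: (@ge0_subset_integral _ _ _ mu _ J _ mJ (fun w => (dG w ^+ 2)%:E)) => //.
- apply/measurable_EFinP; apply: measurable_funTS; apply: continuous_measurable_fun.
  exact: continuous_sqr.
- by move=> w _; rewrite lee_fin sqr_ge0.
Qed.

Lemma wirtinger_cell :
  (((pi / L) ^+ 2)%:E * \int[leb2 R]_(x in cell k m I J) (phi x ^+ 2)%:E <=
   \int[leb2 R]_(x in cell k m I J) ('D_v phi x ^+ 2)%:E)%E.
Proof.
rewrite (ge0_integral_cell k m cf f0 mI mJ) (ge0_integral_cell k m cg g0 mI mJ).
have mF := measurable_inner1 (cS cf) (fun p => f0 (shear k m p)) mJ.
have mG := measurable_inner1 (cS cg) (fun p => g0 (shear k m p)) mJ.
have F0 y : (0 <= \int[mu]_(w in J) (f (shear k m (y, w)))%:E)%E.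
  by apply: integral_ge0 => w _; rewrite lee_fin.
have p0 : 0 <= (pi / L) ^+ 2 by exact: sqr_ge0.
rewrite -(@ge0_integralZl_EFin _ _ _ mu I mI _ (fun y _ => F0 y) (measurable_funTS mF) _ p0).
apply: ge0_le_integral.
- exact: mI.
- by move=> y _; exact: mule_ge0 (F0 y).
- exact: (measurable_funTS (measurable_funeM _ mF)).
- exact: (measurable_funTS mG).
- by move=> y Iy; exact: slice.
Qed.

End WirtingerCell.

(** * Cutting the broken guide into pieces *)

Definition grad2 (R : realType) (phi : R * R -> R) (x : R * R) : R :=
  'D_(e1 R) phi x ^+ 2 + 'D_(e2 R) phi x ^+ 2.

Lemma grad2_ge0 (R : realType) (phi : R * R -> R) x : 0 <= grad2 phi x.
Proof. by rewrite addr_ge0 ?sqr_ge0. Qed.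

Lemma continuous_grad2 (R : realType) (phi : R * R -> R) : Ck 1 phi ->
  continuous (grad2 phi).
Proof.
move=> C x; apply: cvgD.
  exact: (continuous_sqr (Ck_cont_derive (v := e1 R) C)).
exact: (continuous_sqr (Ck_cont_derive (v := e2 R) C)).
Qed.

Lemma derive_sqr_le (R : realType) (phi : R * R -> R) a b x : Ck 1 phi ->
  'D_((a, b)) phi x ^+ 2 <= (a ^+ 2 + b ^+ 2) * grad2 phi x.
Proof.
move=> C; rewrite derive_pair// /grad2.
move: ('D_(e1 R) phi x) ('D_(e2 R) phi x) => p q.
rewrite -subr_ge0.
have -> : (a ^+ 2 + b ^+ 2) * (p ^+ 2 + q ^+ 2) - (a * p + b * q) ^+ 2 =
  (a * q - b * p) ^+ 2 by ring.
exact: sqr_ge0.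
Qed.

Lemma integral_derive_sqr_le (R : realType) (phi : R * R -> R) a b
    (Q : set (measurableTypeR R * measurableTypeR R)) : Ck 1 phi -> measurable Q ->
  (\int[leb2 R]_(x in Q) ('D_((a, b)) phi x ^+ 2)%:E <=
   (a ^+ 2 + b ^+ 2)%:E * \int[leb2 R]_(x in Q) (grad2 phi x)%:E)%E.
Proof.
move=> C mQ.
have mg : measurable_fun Q (fun x => (grad2 phi x)%:E).
  apply/measurable_EFinP; apply: measurable_funTS; apply: continuous2_measurable.
  exact: continuous_grad2.
have ab0 : 0 <= a ^+ 2 + b ^+ 2 by rewrite addr_ge0 ?sqr_ge0.
have g0 x : Q x -> (0 <= (grad2 phi x)%:E)%E by rewrite lee_fin grad2_ge0.
rewrite -(@ge0_integralZl_EFin _ _ _ (leb2 R) Q mQ _ g0 mg _ ab0).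
apply: ge0_le_integral.
- exact: mQ.
- by move=> x _; rewrite lee_fin sqr_ge0.
- apply/measurable_EFinP; apply: measurable_funTS; apply: continuous2_measurable.
  by apply: continuous_sqr; exact: Ck_cont_derive.
- exact: measurable_funeM.
- by move=> x _; rewrite -EFinM lee_fin; exact: derive_sqr_le.
Qed.

Section Guide.
Variables (R : realType) (theta : R).
Hypotheses (theta_gt0 : 0 < theta) (theta_lt : theta < pi / 2).
Local Notation mu := (@lebesgue_measure R).
Local Notation MR := (measurableTypeR R).
Local Notation Omega := (broken_guide theta).

Let c := cos theta.
Let s := sin theta.
Let k := tan theta.

Let c0 : 0 < c.
Proof.
apply: cos_gt0_pihalf; rewrite theta_lt andbT.
by have := pi_gt0 R; move: theta_gt0; lra.
Qed.
Let s0 : 0 < s.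
Proof.
apply: sin_gt0_pi; rewrite theta_gt0/=.
by have := pi_gt0 R; move: theta_lt; lra.
Qed.
Let kE : k = s / c. Proof. by []. Qed.
Let sc : s ^+ 2 + c ^+ 2 = 1. Proof. by rewrite addrC /c /s cos2Dsin2. Qed.
Let k0 : 0 < k. Proof. by rewrite kE divr_gt0. Qed.
Let sE : s = k * c. Proof. by rewrite kE divfK// gt_eqF. Qed.
Let kc : (k ^+ 2 + 1) * c ^+ 2 = 1.
Proof. by move: sc; rewrite sE exprMn mulrDl mul1r. Qed.

(** The points of the upper (resp. lower) half-plane in front of the line through the
    reentrant corner that is perpendicular to the upper (resp. lower) arm. *)
Definition arm_slope (up : bool) : R := if up then tan theta else - tan theta.
Definition arm_side (up : bool) : set MR := 
  if up then `]0, +oo[%classic else `]-oo, 0[%classic.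
Definition arm (up : bool) : set (R * R) :=
  cell (arm_slope up) 0 `]0, +oo[ (arm_side up).

Lemma measurable_arm up : measurable (arm up : set (MR * MR)).
Proof. by apply: measurable_cell; rewrite ?/arm_side; case: up; exact: measurable_itv. Qed.

(** In direction (- k, 1), which is normal to the upper arm, the slice at y meets that
    arm for y s c < w < (y s + pi) c, where s, c are the sine and cosine of theta:
    a segment of length pi c in w, hence of length pi in the plane. The lower arm is
    the mirror image. *)
Lemma poincare_arm (phi : R * R -> R) up : Ck 1 phi ->
  (forall x, ~ Omega x -> phi x = 0) ->
  (\int[leb2 R]_(x in arm up) (phi x ^+ 2)%:E <=
   \int[leb2 R]_(x in arm up) (grad2 phi x)%:E)%E.
Proof.
move=> C phi0.
have pi0 := pi_gt0 R.
have L0 : 0 < pi * c by rewrite mulr_gt0.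
have pc : 0 < pi * c by rewrite mulr_gt0.
have mI : measurable (`]0, +oo[%classic : set MR) by exact: measurable_itv.
have mJ : measurable (arm_side up : set MR) by rewrite /arm_side; case: (up); exact: measurable_itv.
have ks : arm_slope up ^+ 2 = k ^+ 2.
  by rewrite /arm_slope; case: (up); rewrite ?sqrrN.
have W := @wirtinger_cell R (arm_slope up) 0 (pi * c) `]0, +oo[ (arm_side up) phi L0 C mI mJ.
have {W}/W H : forall y, `]0, +oo[%classic y ->
    exists a, `[a, a + pi * c]%classic `<=` arm_side up /\
    forall w, arm_side up w -> ~~ (a < w < a + pi * c) ->
      phi (shear (arm_slope up) 0 (y, w)) = 0.
  move=> y /=; rewrite in_itv/= andbT => y0.
  have ysc : 0 < y * (s * c) by rewrite !mulr_gt0.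
  (* the foot of the slice on the inner wall, or on the outer wall for the lower arm *)
  exists (if up then y * (s * c) else - (y * (s * c) + pi * c)); split.
    move=> w; rewrite /arm_side; case: (up) => /=; rewrite !in_itv/= => /andP[w1 w2].
      by rewrite andbT; lra.
    by lra.
  move=> w Jw wa; apply: phi0 => -[]; rewrite /shear/= mul0r addr0 => h1 h3.
  move/negP: wa; apply.
  have c2 : 0 < c ^+ 2 by rewrite exprn_gt0.
  have E1 : y * (s * c) = c ^+ 2 * (y * k) by rewrite sE; ring.
  have E2 : c ^+ 2 * (pi / s * k) = pi * c by rewrite kE; field; rewrite !gt_eqF.
  have h2' : `|w| < (y - arm_slope up * w) * k + pi / s * k by rewrite -mulrDl; exact: h3.
  rewrite -/k in h1.
  move: Jw h1 h2'; rewrite /arm_side /arm_slope.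
  case: (up) => /=; rewrite in_itv/= ?andbT -/k => w0.
    rewrite (gtr0_norm w0) => h1 h2.
    have g1 : y * k < (k ^+ 2 + 1) * w by move: h1; nra.
    have g2 : (k ^+ 2 + 1) * w < y * k + pi / s * k by move: h2; nra.
    rewrite -(ltr_pM2l c2) in g1; rewrite -(ltr_pM2l c2) in g2.
    have E3 : c ^+ 2 * ((k ^+ 2 + 1) * w) = w by rewrite mulrA [c ^+ 2 * _]mulrC kc mul1r.
    by rewrite mulrDr E2 in g2; rewrite E1; apply/andP; split; lra.
  rewrite (ltr0_norm w0) => h1 h2.
  have g1 : y * k < (k ^+ 2 + 1) * - w by move: h1; nra.
  have g2 : (k ^+ 2 + 1) * - w < y * k + pi / s * k by move: h2; nra.
  rewrite -(ltr_pM2l c2) in g1; rewrite -(ltr_pM2l c2) in g2.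
  have E3 : c ^+ 2 * ((k ^+ 2 + 1) * - w) = - w by rewrite mulrA [c ^+ 2 * _]mulrC kc mul1r.
  by rewrite mulrDr E2 in g2; rewrite E1; apply/andP; split; lra.
have := le_trans H (integral_derive_sqr_le (- arm_slope up) 1 C (measurable_arm up)).
have -> : (- arm_slope up) ^+ 2 + 1 ^+ 2 = (pi / (pi * c)) ^+ 2.
  rewrite sqrrN expr1n ks.
  have -> : pi / (pi * c) = c^-1 by rewrite invfM mulrA divff ?mul1r// gt_eqF.
  have c2 : c ^+ 2 != 0 by rewrite expf_neq0// gt_eqF.
  by apply: (mulIf c2); rewrite kc exprVn mulVf.
by rewrite lee_pmul2l// lte_fin exprn_gt0// divr_gt0.
Qed.

(** With m = 1 / (2 tan theta) the lines of constant w have direction (1 / 2, m),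
    which is normal to the lower arm; so y <= 0 <= w describes the cone between the
    two cutting lines. *)
Definition mesh_slope : R := (2 * tan theta)^-1.

(** Small enough for 2 h^2 times the sum of the squared lengths of the directions
    (1 / 2, m) and (- k, 1) to be at most 1; see [hC]. *)
Definition mesh : R :=
  (1 + 2 * ((1 / 2) ^+ 2 + mesh_slope ^+ 2 + (k ^+ 2 + 1)))^-1.

Definition tile (ij : nat * nat) : set (R * R) :=
  cell (tan theta) mesh_slope
    `]- (ij.1.+1%:R * mesh), - (ij.1.+1%:R * mesh) + mesh]
    `[ij.2%:R * mesh, ij.2%:R * mesh + mesh[.

Let m := mesh_slope.
Let h := mesh.
Let C := (1 / 2) ^+ 2 + m ^+ 2 + (k ^+ 2 + 1).
Let C0 : 0 <= C.
Proof. by rewrite !addr_ge0 ?sqr_ge0. Qed.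

Lemma mesh_gt0 : 0 < mesh.
Proof. by rewrite invr_gt0 ltr_wpDr// mulr_ge0. Qed.

Let h0 : 0 < h. Proof. exact: mesh_gt0. Qed.
Let hC : 2 * h ^+ 2 * C <= 1.
Proof.
have hE : h * (1 + 2 * C) = 1 by rewrite mulVf// gt_eqF// ltr_wpDr// mulr_ge0.
have : 0 <= h * C by rewrite mulr_ge0// ltW.
by move: h0 C0 hE; nra.
Qed.
Let km : 1 - k * m = 1 / 2.
Proof. by rewrite /m /mesh_slope -/k; field; rewrite gt_eqF. Qed.

Lemma measurable_tile ij : measurable (tile ij : set (MR * MR)).
Proof. by apply: measurable_cell; exact: measurable_itv. Qed.

Lemma poincare_tile (phi : R * R -> R) ij : Ck 1 phi ->
  (exists M, forall x, `|phi x| <= M) ->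
  (\int[leb2 R]_(x in tile ij) (phi x ^+ 2)%:E <=
   \int[leb2 R]_(x in tile ij) (grad2 phi x)%:E +
   ((int2 (tile ij) phi / mesh) ^+ 2)%:E)%E.
Proof.
move=> C1 bphi.
apply: le_trans (poincare_cell _ _ _ _ h0 C1 bphi) _.
apply: leeD2r.
have l1 := integral_derive_sqr_le (1 - k * m) m C1 (measurable_tile ij).
have l2 := integral_derive_sqr_le (- k) 1 C1 (measurable_tile ij).
have g0 : (0 <= \int[leb2 R]_(x in tile ij) (grad2 phi x)%:E)%E.
  by apply: integral_ge0 => x _; rewrite lee_fin grad2_ge0.
have h2 : 0 <= 2 * h ^+ 2 by rewrite mulr_ge0// sqr_ge0.
have l12 := leeD l1 l2.
apply: (le_trans (lee_wpmul2l _ l12)); first exact: h2.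
move: g0; move: (\int[leb2 R]_(x in tile ij) (grad2 phi x)%:E)%E => g g0.
rewrite km sqrrN expr1n -ge0_muleDl ?lee_fin ?addr_ge0 ?sqr_ge0//.
rewrite muleA -EFinD -EFinM -/C.
by rewrite -[leRHS]mul1e; apply: lee_wpmul2r => //; rewrite lee_fin.
Qed.

(** On the kite - y and w lie between 0 and the dividend, since there
    x1 > - pi / s and |x2| < pi / c. *)
Definition mesh_size : nat :=
  (Num.truncn ((pi / s + k * (pi / c) + pi / c + m * (pi / s + k * (pi / c))) / h)).+1.

Definition piece (n : nat) (t : bool + 'I_n * 'I_n) : set (R * R) :=
  match t with
  | inl up => arm up
  | inr (i, j) => tile (nat_of_ord i, nat_of_ord j)
  end.

Lemma measurable_piece n t : measurable (@piece n t : set (MR * MR)).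
Proof. by case: t => [up|[i j]]; [exact: measurable_arm|exact: measurable_tile]. Qed.

Lemma armP up x : arm up x <->
  0 < x.1 + arm_slope up * x.2 /\ (if up then 0 < x.2 else x.2 < 0).
Proof.
rewrite /arm /cell /preimage /unshear /mkset /= mul0r subr0 in_itv/= andbT.
by rewrite /arm_side; case: (up); rewrite /= in_itv/= ?andbT.
Qed.

Let Y (x : R * R) := x.1 + k * x.2.
Let W (x : R * R) := x.2 - m * Y x.

Lemma tileP i j x : tile (i, j) x <->
  [/\ i%:R * h <= - Y x, - Y x < i.+1%:R * h, j%:R * h <= W x & W x < j.+1%:R * h].
Proof.
rewrite /tile /cell /preimage /unshear /mkset /= !in_itv/= -/k -/m -/h -/(Y x) -/(W x).
rewrite -[i.+1%:R]natr1 -[j.+1%:R]natr1 !mulrDl !mul1r.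
split=> [[/andP[? ?] /andP[? ?]]|[? ? ? ?]]; first by split; lra.
by split; apply/andP; split; lra.
Qed.

Let WE x : 2 * k * W x = k * x.2 - x.1.
Proof. by rewrite /W /Y /m /mesh_slope -/k; field; rewrite gt_eqF. Qed.

Lemma trivIset_piece n : trivIset setT (@piece n).
Proof.
apply/trivIsetP => t u _ _ tu; rewrite -subset0 => x [].
case: t tu => [t|[i j]]; case: u => [u|[i' j']] tu.
- rewrite /piece !armP; case: t tu; case: u => //= _ [_ ?] [_ ?]; lra.
- rewrite /piece armP tileP /arm_slope -/k => -[t1 t2] [i1 i2 j1 j2].
  have ih : 0 <= i'%:R * h by rewrite mulr_ge0// ltW.
  have jh : 0 <= j'%:R * h by rewrite mulr_ge0// ltW.
  have W0 : 0 <= W x by exact: le_trans jh j1.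
  have : 0 <= 2 * k * W x by apply: (mulr_ge0 _ W0); rewrite mulr_ge0// ltW.
  have : Y x <= 0 by rewrite -oppr_ge0 (le_trans ih i1).
  by rewrite WE /Y; case: (t) t1 t2 => t1 t2; lra.
- rewrite /piece armP tileP /arm_slope -/k => -[i1 i2 j1 j2] [t1 t2].
  have ih : 0 <= i%:R * h by rewrite mulr_ge0// ltW.
  have jh : 0 <= j%:R * h by rewrite mulr_ge0// ltW.
  have W0 : 0 <= W x by exact: le_trans jh j1.
  have : 0 <= 2 * k * W x by apply: (mulr_ge0 _ W0); rewrite mulr_ge0// ltW.
  have : Y x <= 0 by rewrite -oppr_ge0 (le_trans ih i1).
  by rewrite WE /Y; case: (u) t1 t2 => t1 t2; lra.
- rewrite /piece !tileP => -[a1 a2 a3 a4] [b1 b2 b3 b4].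
  have lt1 (p q : nat) (z : R) : p%:R * h <= z -> z < q.+1%:R * h -> (p <= q)%N.
    by move=> /le_lt_trans H /H; rewrite ltr_pM2r// ltr_nat.
  case/eqP: tu; congr (inr (_, _)); apply/val_inj => /=; apply/eqP; rewrite eqn_leq.
    by rewrite (lt1 _ _ _ a1 b2) (lt1 _ _ _ b1 a2).
  by rewrite (lt1 _ _ _ a3 b4) (lt1 _ _ _ b3 a4).
Qed.

(** A point of the guide that is in neither arm lies behind both cutting lines, so
    its coordinates satisfy y <= 0 <= w. *)
Lemma guide_covered x : Omega x -> exists t, @piece mesh_size t x.
Proof.
move=> [w1 w2].
have [|nU] := pselect (arm true x); first by exists (inl true).
have [|nD] := pselect (arm false x); first by exists (inl false).
have YY : Y x <= 0 /\ x.1 - k * x.2 <= 0.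
  rewrite /Y; move: nU nD; rewrite !armP /arm_slope -/k => nU nD.
  have [x0|x0|x0] := ltgtP x.2 0.
  - have : x.1 - k * x.2 <= 0.
      by rewrite leNgt; apply/negP => H; apply: nD; split => //; rewrite mulNr.
    have : k * x.2 <= 0 by rewrite mulr_ge0_le0// ltW.
    by lra.
  - have : x.1 + k * x.2 <= 0 by rewrite leNgt; apply/negP => H; apply: nU; split.
    have : 0 <= k * x.2 by rewrite mulr_ge0// ltW.
    by lra.
  - move: w1; rewrite x0 normr0 -/k mulr0 addr0 subr0 => w1'.
    have : x.1 < 0 by rewrite -(pmulr_llt0 _ k0).
    by lra.
have [YL0 Y'L0] := YY.
have k2 : 0 < 2 * k by rewrite mulr_gt0.
have W0 : 0 <= W x by rewrite -(pmulr_rge0 _ k2) WE; lra.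
have m0 : 0 < m by rewrite /m /mesh_slope invr_gt0 mulr_gt0.
pose L := pi / s + k * (pi / c) + pi / c + m * (pi / s + k * (pi / c)).
have pis : 0 < pi / s by rewrite divr_gt0 ?pi_gt0.
have pic : 0 < pi / c by rewrite divr_gt0 ?pi_gt0.
have kx : k * `|x.2| <= - x.1.
  rewrite /Y in YL0.
  by have [x0|x0] := leP 0 x.2; rewrite ?(ger0_norm x0) ?(ltr0_norm x0); lra.
have psk : pi / s * k = pi / c by rewrite kE; field; rewrite !gt_eqF.
have x2b : `|x.2| < x.1 * k + pi / c by rewrite -psk -mulrDl.
have x1b : - (pi / s) < x.1.
  have : 0 < (x.1 + pi / s) * k by apply: le_lt_trans w2.
  by rewrite (pmulr_lgt0 _ k0); lra.
have x1n : x.1 <= 0 by have := mulr_ge0 (ltW k0) (normr_ge0 x.2); lra.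
have x2c : `|x.2| < pi / c.
  have : x.1 * k <= 0 by rewrite mulr_le0_ge0// ltW.
  by lra.
have YL : - Y x < pi / s + k * (pi / c).
  have : k * `|x.2| < k * (pi / c) by rewrite ltr_pM2l.
  have : - x.2 <= `|x.2| by rewrite -normrN ler_norm.
  by move=> /(ler_wpM2l (ltW k0)); rewrite /Y; lra.
have WL : W x < L.
  have : m * - Y x <= m * (pi / s + k * (pi / c)) by rewrite ler_pM2l// ltW.
  have : x.2 <= `|x.2| by exact: ler_norm.
  have : 0 < k * (pi / c) by rewrite mulr_gt0.
  by rewrite /W /L; lra.
have YL' : - Y x < L.
  have : 0 < m * (pi / s + k * (pi / c)) by rewrite mulr_gt0// addr_gt0// mulr_gt0.
  by rewrite /L; lra.
have idx z : 0 <= z -> z < L -> exists i : 'I_mesh_size, i%:R * h <= z < i.+1%:R * h.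
  move=> z0 zL.
  have zh : 0 <= z / h by rewrite divr_ge0// ltW.
  have /andP[t1 t2] := truncn_itv zh.
  have tN : (Num.truncn (z / h) < mesh_size)%N.
    rewrite /mesh_size ltnS; apply: le_truncn.
    by apply: ler_wpM2r; [rewrite invr_ge0 ltW|exact: ltW].
  exists (Ordinal tN) => /=.
  by rewrite -ler_pdivlMr// -ltr_pdivrMr// t1 t2.
have [i /andP[i1 i2]] := idx (- Y x) ltac:(lra) YL'.
have [j /andP[j1 j2]] := idx (W x) W0 WL.
by exists (inr (i, j)); rewrite /piece tileP.
Qed.

End Guide.

(** * Square-integrable functions *)

Section L2theory.
Variable R : realType.
Local Notation MR := (measurableTypeR R).
Variable D : set (MR * MR).
Hypothesis mD : measurable D.
Implicit Types f g h : R * R -> R.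
Local Notation dot f g := (int2 D (fun x => f x * g x)).

Lemma L2_integrableM f g : L2 D f -> L2 D g ->
  (leb2 R).-integrable D (EFin \o (fun x => f x * g x)).
Proof.
move=> [mf f2] [mg g2].
apply: (le_integrable mD _ _ (integrableD mD f2 g2)).
  by apply/measurable_EFinP; exact: measurable_funM.
move=> x _ /=; rewrite lee_fin [leRHS]ger0_norm ?addr_ge0 ?sqr_ge0// normrM.
have := sqr_ge0 (`|f x| - `|g x|); have := sqr_ge0 (f x); have := sqr_ge0 (g x).
rewrite -![_ x ^+ 2]real_normK ?num_real//.
by move: (`|f x|) (`|g x|) => p q; nra.
Qed.

Lemma L2Z (c : R) f : L2 D f -> L2 D (fun x => c * f x).
Proof.
move=> [mf f2]; split; first by apply: measurable_funM => //; exact: measurable_cst.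
have := integrableZl mD (c ^+ 2) f2.
by apply: eq_integrable => // x _; rewrite -EFinM exprMn.
Qed.

Lemma L2D f g : L2 D f -> L2 D g -> L2 D (fun x => f x + g x).
Proof.
move=> Lf Lg; have fg := L2_integrableM Lf Lg.
move: Lf Lg => [mf f2] [mg g2]; split; first exact: measurable_funD.
have := integrableD mD (integrableD mD f2 g2) (integrableZl mD 2 fg).
apply: eq_integrable => // x _ /=.
by rewrite -EFinM -!EFinD; congr EFin; ring.
Qed.

Lemma L2B f g : L2 D f -> L2 D g -> L2 D (fun x => f x - g x).
Proof.
move=> Lf Lg; rewrite (_ : (fun x => _) = (fun x => f x + (-1) * g x)).
  by apply: L2D => //; exact: L2Z.
by apply/funext => x; rewrite mulN1r.
Qed.

Lemma dotC f g : dot f g = dot g f.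
Proof. by rewrite /int2; apply: eq_Rintegral => x _; rewrite mulrC. Qed.

Lemma dotZl (c : R) f g : L2 D f -> L2 D g -> dot (fun x => c * f x) g = c * dot f g.
Proof.
move=> Lf Lg; rewrite /int2 -RintegralZl//; last exact: L2_integrableM.
by apply: eq_Rintegral => x _; rewrite mulrA.
Qed.

Lemma dotDl f g h : L2 D f -> L2 D g -> L2 D h ->
  dot (fun x => f x + g x) h = dot f h + dot g h.
Proof.
move=> Lf Lg Lh; rewrite /int2 -RintegralD//; last 2 first.
- exact: L2_integrableM.
- exact: L2_integrableM.
by apply: eq_Rintegral => x _; rewrite mulrDl.
Qed.

Lemma dotBl f g h : L2 D f -> L2 D g -> L2 D h ->
  dot (fun x => f x - g x) h = dot f h - dot g h.
Proof.
move=> Lf Lg Lh; rewrite /int2 -RintegralB//; last 2 first.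
- exact: L2_integrableM.
- exact: L2_integrableM.
by apply: eq_Rintegral => x _; rewrite mulrBl.
Qed.

Lemma dot_ge0 f : 0 <= dot f f.
Proof. by apply: Rintegral_ge0 => x _; rewrite -expr2 sqr_ge0. Qed.

Lemma dotE f : L2 D f -> (\int[leb2 R]_(x in D) (f x ^+ 2)%:E = (dot f f)%:E)%E.
Proof.
move=> Lf; rewrite /int2 /Rintegral fineK; first by apply: eq_integral => x _; rewrite expr2.
by apply: integrable_fin_num => //; exact: L2_integrableM.
Qed.

Lemma dot_cauchy_schwarz f g : L2 D f -> L2 D g ->
  dot f g ^+ 2 <= dot f f * dot g g.
Proof.
move=> Lf Lg.
have Q (t : R) : 0 <= dot f f - 2 * t * dot f g + t ^+ 2 * dot g g.
  have Lt := L2Z t Lg; have LB := L2B Lf Lt.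
  have := dot_ge0 (fun x => f x - t * g x).
  pose e x := f x - t * g x.
  rewrite dotBl// dotZl// (dotC f e) (dotC g e) !dotBl// !dotZl// (dotC g f).
  by congr (0 <= _); ring.
have [g0|g0] := eqVneq (dot g g) 0.
  rewrite g0 mulr0; move: Q; rewrite g0 => Q.
  have [fg0|fg0] := eqVneq (dot f g) 0; first by rewrite fg0 expr0n.
  have := Q ((dot f f + 1) / (2 * dot f g)).
  have -> : 2 * ((dot f f + 1) / (2 * dot f g)) * dot f g = dot f f + 1.
    by field.
  by rewrite mulr0; lra.
have gp : 0 < dot g g by rewrite lt_neqAle eq_sym g0 dot_ge0.
have := Q (dot f g / dot g g).
have -> : dot f f - 2 * (dot f g / dot g g) * dot f g + (dot f g / dot g g) ^+ 2 * dot g g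
  = (dot f f * dot g g - dot f g ^+ 2) / dot g g by field.
by rewrite pmulr_lge0 ?invr_gt0// subr_ge0.
Qed.

(** In the applications f is the difference between a function and its
    approximation, of norm at most d. *)
Lemma dot_le_dist f g (d : R) : L2 D f -> L2 D g -> 0 <= d -> dot f f <= d ^+ 2 ->
  `|dot f g| <= d * Num.sqrt (dot g g).
Proof.
move=> Lf Lg d0 fd.
rewrite -[leRHS]ger0_norm ?mulr_ge0 ?sqrtr_ge0// -ler_sqr ?nnegrE//.
rewrite !real_normK ?num_real// exprMn sqr_sqrtr ?dot_ge0//.
by apply: le_trans (dot_cauchy_schwarz Lf Lg) _; rewrite ler_wpM2r// dot_ge0.
Qed.

Lemma L2_indic (Q : set (MR * MR)) : measurable Q -> (leb2 R Q < +oo)%E ->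
  L2 D (\1_Q : R * R -> R).
Proof.
move=> mQ Qfin; split; first exact: measurable_funTS.
have : (leb2 R).-integrable D (EFin \o (\1_Q : R * R -> R)).
  apply: (integrableS measurableT mD) => //.
  apply/integrableP; split; first by apply/measurable_EFinP; exact: measurable_indic.
  rewrite (eq_integral (fun x => (\1_Q x)%:E)); last first.
    by move=> t _; rewrite gee0_abs// lee_fin.
  by rewrite integral_indic// setIT.
apply: eq_integrable => // x _ /=.
by rewrite indicE; case: (x \in Q); rewrite ?expr1n// expr0n.
Qed.

Lemma compact_supp_bounded f : continuous f -> compact (supp f) ->
  exists2 M, 0 <= M & forall x, `|f x| <= M.
Proof.
move=> cf Kf.
have : compact (f @` supp f).
  by apply: continuous_compact Kf; exact: continuous_subspaceT.
move=> /compact_bounded[M [_ HM]].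
exists (`|M| + 1); first by rewrite addr_ge0.
move=> x; have [xs|/supp0 ->] := pselect (supp f x).
  by apply: HM; [rewrite ltr_pwDr// ler_norm|exists x].
by rewrite normr0 addr_ge0.
Qed.

Lemma L2_compact_supp f : continuous f -> compact (supp f) -> L2 D f.
Proof.
move=> cf Kf; split; first by apply: measurable_funTS; exact: continuous2_measurable.
have [M M0 fM] := compact_supp_bounded cf Kf.
have [B [_ HB]] := compact_bounded Kf.
pose b := `|B| + 1.
have b0 : 0 < b by rewrite ltr_wpDl.
pose I : set MR := `[- b, b]%classic.
have mI : measurable I by exact: measurable_itv.
pose box : set (MR * MR) := I `*` I.
have mbox : measurable box by exact: measurableX.
have boxf : (leb2 R box < +oo)%E.
  have -> : leb2 R box = (@lebesgue_measure R I * @lebesgue_measure R I)%E.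
    exact: product_measure1E.
  by rewrite /I lebesgue_measure_itv/= lte_fin; case: ifP => _; rewrite -?EFinB -EFinM ltry.
have f2box : (leb2 R).-integrable box (EFin \o (fun x => f x ^+ 2)).
  apply: measurable_bounded_integrable => //.
    by apply: measurable_funTS; apply: continuous2_measurable; exact: continuous_sqr.
  exists (M ^+ 2); split; first exact: num_real.
  move=> N MN x _; apply: le_trans (ltW MN).
  by rewrite normrX ler_sqr ?nnegrE.
apply: (integrableS measurableT) => //.
move: f2box => /(integrable_mkcond _ mbox).
apply: eq_integrable => // x _; rewrite patchE; case: ifPn => // xb.
suff -> : f x = 0 by rewrite /= expr0n.
apply: supp0 => xs; move/negP: xb; apply; rewrite inE /box /=.
have : `|x| <= b by apply: HB; rewrite // ltr_pwDr// ler_norm.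
rewrite prod_normE ge_max /= => /andP[].
by rewrite !ler_norml => h1 h2; split; rewrite /I /= in_itv/=.
Qed.

End L2theory.

(** * The form inequality for test functions *)

Section TestInequality.
Variables (R : realType) (theta : R).
Hypotheses (theta_gt0 : 0 < theta) (theta_lt : theta < pi / 2).
Local Notation MR := (measurableTypeR R).
Local Notation Omega := (broken_guide theta).
Local Notation n := (mesh_size theta).
Local Notation dot f g := (int2 Omega (fun x => f x * g x)).

Lemma measurable_guide : measurable (Omega : set (MR * MR)).
Proof.
have mlt (f g : R * R -> R) : continuous f -> continuous g ->
    measurable ([set x | f x < g x] : set (MR * MR)).
  move=> cf cg; rewrite (_ : [set x | f x < g x] = (fun x => g x - f x) @^-1` `]0, +oo[%classic).
    apply: open2_measurable; apply: open_comp; last exact: interval_open.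
    by move=> x _; apply: cvgB; [exact: cg|exact: cf].
  by apply/seteqP; split=> x /=; rewrite in_itv/= andbT subr_gt0.
have cx1 : continuous (fun x : R * R => x.1) by move=> x; exact: cvg_fst.
have cx2 : continuous (fun x : R * R => `|x.2|).
  by move=> x; apply: cvg_norm; exact: cvg_snd.
apply: measurableI.
  apply: (mlt (fun x => x.1 * tan theta) (fun x => `|x.2|)) => // x.
  by apply: cvgM; [exact: cx1|exact: cvg_cst].
apply: (mlt (fun x => `|x.2|) (fun x => (x.1 + pi / sin theta) * tan theta)) => // x.
apply: cvgM; last exact: cvg_cst.
by apply: cvgD; [exact: cx1|exact: cvg_cst].
Qed.

(** Since phi and its derivatives vanish outside the guide, integrals over the guide,
    over the union of the pieces and over the plane agree. *)
Lemma test_function_inequality phi : test_function Omega phi ->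
  dot phi phi <= dot ('D_(e1 R) phi) ('D_(e1 R) phi) + dot ('D_(e2 R) phi) ('D_(e2 R) phi)
    + \sum_(ij : 'I_n * 'I_n)
        (dot phi (\1_(tile theta (ij.1 : nat, ij.2 : nat)) : R * R -> R) / mesh theta) ^+ 2.
Proof.
move=> tphi; have [Cphi Kphi Sphi] := tphi.
have C1 := Cphi 1%N; have mO := measurable_guide.
have cphi : continuous phi := Ck_cont C1.
have out x : ~ Omega x -> ~ supp phi x by move=> + /Sphi.
have phi0 x : ~ Omega x -> phi x = 0 by move=> /out; exact: supp0.
have g0 x : ~ Omega x -> grad2 phi x = 0.
  by move=> /out ox; rewrite /grad2 !derive_supp0// expr0n addr0.
have [M _ bM] := compact_supp_bounded cphi Kphi.
pose P := @piece R theta n.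
pose T : finType := (bool + 'I_n * 'I_n)%type.
pose U := \big[setU/set0]_(t <- index_enum T) P t.
have UP x t : P t x -> U x.
  move=> Ptx; rewrite /U -bigcup_seq; exists t => //=; exact: mem_index_enum.
have mU : measurable (U : set (MR * MR)).
  by apply: bigsetU_measurable => t _; exact: measurable_piece.
have mf (f : R * R -> R) (Q : set (MR * MR)) : continuous f -> measurable_fun Q (fun x => (f x)%:E).
  by move=> cf; apply/measurable_EFinP; apply: measurable_funTS; exact: continuous2_measurable.
have cphi2 := continuous_sqr cphi.
have cg := continuous_grad2 C1.
pose e (t : T) : R := match t with inl _ => 0
  | inr ij => (int2 (tile theta (ij.1 : nat, ij.2 : nat)) phi / mesh theta) ^+ 2 end.
have E1 : (\int[leb2 R]_(x in Omega) (phi x ^+ 2)%:E =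
           \int[leb2 R]_(x in U) (phi x ^+ 2)%:E)%E.
  rewrite integral_mkcond [RHS]integral_mkcond; apply: eq_integral => x _.
  rewrite !patchE; have [xO|xO] := pselect (Omega x).
    rewrite !mem_set//; have [t Pt] := guide_covered theta_gt0 theta_lt xO.
    exact: UP Pt.
  by rewrite phi0// expr0n/= !if_same.
have split_U (f : R * R -> R) : continuous f -> (forall x, 0 <= f x) ->
  (\int[leb2 R]_(x in U) (f x)%:E = \sum_(t <- index_enum T) \int[leb2 R]_(x in P t) (f x)%:E)%E.
  move=> cf f0; rewrite ge0_integral_bigsetU//.
  - by move=> t; exact: measurable_piece.
  - exact: index_enum_uniq.
  - by apply: sub_trivIset (trivIset_piece theta_gt0 theta_lt (n := n)).
  - exact: mf.
  - by move=> x _; rewrite lee_fin.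
have E2 : (\int[leb2 R]_(x in U) (phi x ^+ 2)%:E <=
   \int[leb2 R]_(x in U) (grad2 phi x)%:E + (\sum_(t <- index_enum T) e t)%:E)%E.
  rewrite (split_U _ cphi2 (fun x => sqr_ge0 _)) (split_U _ cg (grad2_ge0 _)).
  rewrite -sumEFin -big_split/=; apply: lee_sum => -[up|[i j]] _.
    by rewrite adde0; exact: poincare_arm.
  by apply: poincare_tile => //; exists M.
have E3 : (\int[leb2 R]_(x in U) (grad2 phi x)%:E <=
           \int[leb2 R]_(x in Omega) (grad2 phi x)%:E)%E.
  have -> : (\int[leb2 R]_(x in Omega) (grad2 phi x)%:E = \int[leb2 R]_x (grad2 phi x)%:E)%E.
    rewrite integral_mkcond; apply: eq_integral => x _.
    rewrite patchE; case: ifPn => // /negP xO; rewrite g0// => H; apply: xO; exact: mem_set.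
  apply: ge0_subset_integral => //; first exact: mf.
  by move=> x _; rewrite lee_fin grad2_ge0.
have L2d v : L2 Omega ('D_v phi).
  have [C' K' _] := test_derive v tphi.
  by apply: L2_compact_supp => //; exact: Ck_cont (C' 0%N).
have E4 : (\int[leb2 R]_(x in Omega) (grad2 phi x)%:E =
  (dot ('D_(e1 R) phi) ('D_(e1 R) phi) + dot ('D_(e2 R) phi) ('D_(e2 R) phi))%:E)%E.
  have q0 v x : Omega x -> (0 <= ('D_v phi x ^+ 2)%:E)%E by rewrite lee_fin sqr_ge0.
  have mq v : measurable_fun Omega (fun x => ('D_v phi x ^+ 2)%:E).
    by apply: mf; apply: continuous_sqr; exact: Ck_cont_derive.
  apply: etrans (@ge0_integralD _ _ _ (leb2 R) _ mO _ _
    (q0 (e1 R)) (mq (e1 R)) (q0 (e2 R)) (mq (e2 R))) _.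
  by rewrite [RHS]EFinD; congr (_ + _)%E; [exact: (dotE mO (L2d _))|exact: (dotE mO (L2d _))].
have Lphi : L2 Omega phi by apply: L2_compact_supp.
have E5 : (\sum_(t <- index_enum T) e t)%R = \sum_(ij : 'I_n * 'I_n)
    (dot phi (\1_(tile theta (ij.1 : nat, ij.2 : nat)) : R * R -> R) / mesh theta) ^+ 2.
  rewrite -/(index_enum T) big_sumType/= big1 ?add0r//.
  apply: eq_bigr => ij _; congr ((_ / _) ^+ 2).
  rewrite /int2 Rintegral_mkcond [RHS]Rintegral_mkcond; apply: eq_Rintegral => x _.
  rewrite !patchE indicE; case: (x \in tile _ _); rewrite ?mulr1 ?mulr0.
    by case: ifPn => // /negP xO; rewrite phi0// => H; apply: xO; exact: mem_set.
  by rewrite if_same.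
rewrite -lee_fin -(dotE mO Lphi) E1 -E5 EFinD -E4.
by apply: le_trans E2 _; exact: leeD2r.
Qed.

End TestInequality.

(** * Extension to the Sobolev space *)

(** Errors of order d in the approximations disappear in the limit. *)
Lemma le_of_small_error (R : realType) (a b K : R) : 0 <= K ->
  (forall d, 0 < d -> d <= 1 -> a <= b + d * K) -> a <= b.
Proof.
move=> K0 H; apply/ler_addgt0Pl => e e0.
have K1 : 0 < K + e by rewrite ltr_wpDl.
have := H (e / (K + e)) (divr_gt0 e0 K1).
rewrite ler_pdivrMr// mul1r lerDr => /(_ K0) /le_trans; apply.
rewrite addrC lerD2r mulrAC ler_pdivrMr//.
by rewrite ler_pM2l// lerDl ltW.
Qed.

Lemma le_of_eq (R : realType) (a b : R) : a = b -> a <= b.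
Proof. by move=> ->. Qed.

Section H10theory.
Variable R : realType.
Local Notation MR := (measurableTypeR R).
Variable D : set (MR * MR).
Hypothesis mD : measurable D.
Implicit Types f g h phi : R * R -> R.
Local Notation dot f g := (int2 D (fun x => f x * g x)).
Local Notation e1 := (e1 R).
Local Notation e2 := (e2 R).

Lemma test_L2 phi : test_function D phi -> L2 D phi.
Proof. by move=> [C K _]; apply: L2_compact_supp => //; exact: Ck_cont (C 0%N). Qed.

(** The approximation clause of [H10], stated with one bound for each term. *)
Definition H1_approx f g1 g2 := forall d : R, 0 < d ->
  exists phi, [/\ test_function D phi,
    dot (fun x => f x - phi x) (fun x => f x - phi x) <= d ^+ 2,
    dot (fun x => g1 x - 'D_e1 phi x) (fun x => g1 x - 'D_e1 phi x) <= d ^+ 2 &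
    dot (fun x => g2 x - 'D_e2 phi x) (fun x => g2 x - 'D_e2 phi x) <= d ^+ 2].

Let sum3E f g h : L2 D f -> L2 D g -> L2 D h ->
  (\int[leb2 R]_(x in D) (f x ^+ 2 + g x ^+ 2 + h x ^+ 2)%:E
   = (dot f f + dot g g + dot h h)%:E)%E.
Proof.
move=> Lf Lg Lh.
have q0 (f' : R * R -> R) x : D x -> (0 <= (f' x ^+ 2)%:E)%E by rewrite lee_fin sqr_ge0.
have mq f' : L2 D f' -> measurable_fun D (fun x => (f' x ^+ 2)%:E).
  by move=> [mf' _]; apply/measurable_EFinP; exact: measurable_funX.
rewrite 2!EFinD -(dotE mD Lf) -(dotE mD Lg) -(dotE mD Lh).
rewrite -(@ge0_integralD _ _ _ (leb2 R) _ mD _ _ (q0 f) (mq _ Lf) (q0 g) (mq _ Lg)).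
rewrite -ge0_integralD//.
- by move=> x Dx; rewrite adde_ge0// q0.
- by apply: emeasurable_funD; [exact: (mq _ Lf)|exact: (mq _ Lg)].
- by move=> x Dx; exact: q0.
- exact: (mq _ Lh).
Qed.

Lemma H10_approx f : H10 D f -> L2 D f /\ exists g1 g2,
  [/\ L2 D g1 /\ L2 D g2, weak_partial D e1 f g1, weak_partial D e2 f g2 &
      H1_approx f g1 g2].
Proof.
move=> [Lf [g1 [g2 [[L1 L2'] w1 w2 H]]]]; split => //; exists g1, g2; split => // d d0.
have [phi tphi] := H (d ^+ 2) (exprn_gt0 _ d0).
have Lt := test_L2 tphi.
have Lt1 := test_L2 (test_derive e1 tphi).
have Lt2 := test_L2 (test_derive e2 tphi).
rewrite (sum3E (L2B mD Lf Lt) (L2B mD L1 Lt1) (L2B mD L2' Lt2)) lte_fin => lt3.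
exists phi; split.
- exact: tphi.
- by apply: le_trans (ltW lt3); rewrite -addrA lerDl addr_ge0 ?dot_ge0.
- by apply: le_trans (ltW lt3); rewrite addrAC lerDr addr_ge0 ?dot_ge0.
- by apply: le_trans (ltW lt3); rewrite lerDr addr_ge0 ?dot_ge0.
Qed.

Lemma approx_H10 f g1 g2 : L2 D f -> L2 D g1 -> L2 D g2 ->
  weak_partial D e1 f g1 -> weak_partial D e2 f g2 -> H1_approx f g1 g2 -> H10 D f.
Proof.
move=> Lf L1 L2' w1 w2 H; split => //; exists g1, g2; split => // eps eps0.
pose d := Num.sqrt (eps / 4).
have d0 : 0 < d by rewrite sqrtr_gt0 divr_gt0.
have d2 : d ^+ 2 = eps / 4 by rewrite sqr_sqrtr// divr_ge0// ltW.
have [phi [tphi n0 n1 n2]] := H d d0; exists phi => //.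
have Lt := test_L2 tphi.
have Lt1 := test_L2 (test_derive e1 tphi).
have Lt2 := test_L2 (test_derive e2 tphi).
rewrite (sum3E (L2B mD Lf Lt) (L2B mD L1 Lt1) (L2B mD L2' Lt2)) lte_fin.
apply: le_lt_trans (lerD (lerD n0 n1) n2) _; rewrite d2.
by clear -eps0; lra.
Qed.

Local Notation nrm f := (Num.sqrt (dot f f)).

Lemma dot_approx u v w (d : R) : L2 D u -> L2 D v -> L2 D w -> 0 <= d ->
  dot (fun x => u x - v x) (fun x => u x - v x) <= d ^+ 2 ->
  `|dot u w - dot v w| <= d * nrm w.
Proof.
move=> Lu Lv Lw d0 H; rewrite -(dotBl mD Lu Lv Lw).
by apply: dot_le_dist => //; exact: L2B.
Qed.

Lemma dot_expand u v : L2 D u -> L2 D v ->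
  dot v v = dot u u - 2 * dot (fun x => u x - v x) u +
    dot (fun x => u x - v x) (fun x => u x - v x).
Proof.
move=> Lu Lv; have Le := L2B mD Lu Lv.
rewrite (dotBl mD Lu Lv Lu) (dotBl mD Lu Lv Le).
rewrite (dotC _ u (fun x => u x - v x)) (dotC _ v (fun x => u x - v x)).
rewrite (dotBl mD Lu Lv Lu) (dotBl mD Lu Lv Lv) (dotC _ v u).
by ring.
Qed.

Lemma normsq_approx u v (d : R) : L2 D u -> L2 D v -> 0 <= d ->
  dot (fun x => u x - v x) (fun x => u x - v x) <= d ^+ 2 ->
  `|dot v v - dot u u| <= 2 * d * nrm u + d ^+ 2.
Proof.
have arith (vv uu eu ee nu d' d2 : R) : vv = uu - 2 * eu + ee -> 0 <= ee ->
    `|eu| <= d' * nu -> ee <= d2 -> `|vv - uu| <= 2 * d' * nu + d2.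
  by move=> -> ?; rewrite !ler_norml => /andP[? ?] ?; apply/andP; split; lra.
move=> Lu Lv d0 H.
exact: arith (dot_expand Lu Lv) (dot_ge0 D _) (dot_le_dist mD (L2B mD Lu Lv) Lu d0 H) H.
Qed.

(** For a test function phi the definition of the weak derivatives, applied to the
    derivatives of phi, gives - <h, phi> = <g1, d1 phi> + <g2, d2 phi>; let phi
    tend to f. *)
Lemma green_le f g1 g2 h : L2 D f -> L2 D g1 -> L2 D g2 -> L2 D h ->
  weak_partial D e1 f g1 -> weak_partial D e2 f g2 -> H1_approx f g1 g2 ->
  weak_laplacian D f h ->
  dot g1 g1 + dot g2 g2 <= - dot h f.
Proof.
have arith (hf hp a p b q nh n1 n2 d : R) : - hp = p + q ->
    `|hf - hp| <= d * nh -> `|a - p| <= d * n1 -> `|b - q| <= d * n2 ->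
    a + b <= - hf + d * (nh + n1 + n2).
  by move=> E; rewrite !ler_norml => /andP[_ A0] /andP[_ A1] /andP[_ A2]; lra.
have arith' (x y hp p q : R) : x + y = hp -> x = - p -> y = - q -> - hp = p + q.
  by move=> <- -> ->; rewrite opprD !opprK.
move=> Lf L1 L2' Lh w1 w2 H wl.
apply: (@le_of_small_error _ _ _ (nrm h + nrm g1 + nrm g2)).
  by rewrite !addr_ge0// sqrtr_ge0.
move=> d d0 _; have [phi [tphi n0 n1 n2]] := H d d0.
have Lt := test_L2 tphi.
have t1 := test_derive e1 tphi; have t2 := test_derive e2 tphi.
have Lt1 := test_L2 t1; have Lt2 := test_L2 t2.
have Lt11 := test_L2 (test_derive e1 t1); have Lt22 := test_L2 (test_derive e2 t2).
have E : - dot h phi = dot g1 ('D_e1 phi) + dot g2 ('D_e2 phi).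
  have S : int2 D (fun x => f x * ('D_e1 ('D_e1 phi) x + 'D_e2 ('D_e2 phi) x)) =
      dot f ('D_e1 ('D_e1 phi)) + dot f ('D_e2 ('D_e2 phi)).
    apply: etrans (dotC D f _) (etrans (dotDl mD Lt11 Lt22 Lf) _).
    exact: congr2 (dotC D _ f) (dotC D _ f).
  exact: arith' (etrans (esym S) (wl _ tphi)) (w1 _ t1) (w2 _ t2).
have A0 := dot_approx Lf Lt Lh (ltW d0) n0.
have A1 := dot_approx L1 Lt1 L1 (ltW d0) n1.
have A2 := dot_approx L2' Lt2 L2' (ltW d0) n2.
rewrite (dotC _ f h) (dotC _ phi h) in A0.
rewrite (dotC _ ('D_e1 phi) g1) in A1.
rewrite (dotC _ ('D_e2 phi) g2) in A2.
exact: arith E A0 A1 A2.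
Qed.

Lemma weak_partialD v f1 f2 g1 g2 : L2 D f1 -> L2 D f2 -> L2 D g1 -> L2 D g2 ->
  weak_partial D v f1 g1 -> weak_partial D v f2 g2 ->
  weak_partial D v (fun x => f1 x + f2 x) (fun x => g1 x + g2 x).
Proof.
move=> L1 L2' M1 M2 w1 w2 phi tphi.
have Lt := test_L2 tphi; have Ltv := test_L2 (test_derive v tphi).
by rewrite (dotDl mD L1 L2' Ltv) (dotDl mD M1 M2 Lt) w1// w2// opprD.
Qed.

Lemma weak_partialZ v (c : R) f g : L2 D f -> L2 D g ->
  weak_partial D v f g -> weak_partial D v (fun x => c * f x) (fun x => c * g x).
Proof.
move=> Lf Lg w phi tphi.
have Lt := test_L2 tphi; have Ltv := test_L2 (test_derive v tphi).
by rewrite (dotZl mD c Lf Ltv) (dotZl mD c Lg Lt) w// mulrN.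
Qed.

Lemma test_laplacian_L2 phi : test_function D phi ->
  L2 D (fun x => 'D_e1 ('D_e1 phi) x + 'D_e2 ('D_e2 phi) x).
Proof.
move=> t; apply: L2D => //; apply: test_L2; apply: test_derive; exact: test_derive.
Qed.

Lemma weak_laplacianD f1 f2 h1 h2 : L2 D f1 -> L2 D f2 -> L2 D h1 -> L2 D h2 ->
  weak_laplacian D f1 h1 -> weak_laplacian D f2 h2 ->
  weak_laplacian D (fun x => f1 x + f2 x) (fun x => h1 x + h2 x).
Proof.
move=> L1 L2' M1 M2 w1 w2 phi tphi.
have Lt := test_L2 tphi; have Ltv := test_laplacian_L2 tphi.
by rewrite (dotDl mD L1 L2' Ltv) (dotDl mD M1 M2 Lt) w1// w2.
Qed.

Lemma weak_laplacianZ (c : R) f h : L2 D f -> L2 D h ->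
  weak_laplacian D f h -> weak_laplacian D (fun x => c * f x) (fun x => c * h x).
Proof.
move=> Lf Lg w phi tphi.
have Lt := test_L2 tphi; have Ltv := test_laplacian_L2 tphi.
by rewrite (dotZl mD c Lf Ltv) (dotZl mD c Lg Lt) w.
Qed.

Let approxZ (c d : R) u v : L2 D u -> L2 D v -> 0 <= d ->
  dot (fun x => u x - v x) (fun x => u x - v x) <= (d / (`|c| + 1)) ^+ 2 ->
  dot (fun x => c * u x - c * v x) (fun x => c * u x - c * v x) <= d ^+ 2.
Proof.
move=> Lu Lv d0 H.
pose e x := u x - v x.
have Le : L2 D e by exact: L2B.
have c1 : 0 < `|c| + 1 by rewrite ltr_wpDl.
have -> : dot (fun x => c * u x - c * v x) (fun x => c * u x - c * v x) = c ^+ 2 * dot e e.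
  rewrite expr2 -mulrA -(dotZl mD c Le Le) (dotC _ _ e) -(dotZl mD c Le (L2Z mD c Le)).
  by rewrite /int2; apply: eq_Rintegral => x _; rewrite /e; ring.
apply: le_trans (ler_wpM2l (sqr_ge0 c) H) _.
have dc0 : 0 <= d / (`|c| + 1) by rewrite divr_ge0// ltW.
rewrite -exprMn -[leLHS]real_normK ?num_real// ler_sqr ?nnegrE// normrM (ger0_norm dc0).
by rewrite mulrA ler_pdivrMr// [_ * d]mulrC ler_wpM2l// lerDl.
Qed.

Lemma dot_sum_le a b : L2 D a -> L2 D b ->
  dot (fun x => a x + b x) (fun x => a x + b x) <= 2 * (dot a a + dot b b).
Proof.
move=> La Lb; have Lp := L2D mD La Lb; have Lm := L2B mD La Lb.
have := dot_ge0 D (fun x => a x - b x).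
rewrite (dotDl mD La Lb Lp) (dotBl mD La Lb Lm).
rewrite (dotC _ a (fun x => a x + b x)) (dotC _ b (fun x => a x + b x)).
rewrite (dotC _ a (fun x => a x - b x)) (dotC _ b (fun x => a x - b x)).
rewrite (dotDl mD La Lb La) (dotDl mD La Lb Lb) (dotBl mD La Lb La) (dotBl mD La Lb Lb).
rewrite (dotC _ b a); clear.
by move: (dot a a) (dot b b) (dot a b) => p q r; lra.
Qed.

Let approxD (d : R) u1 v1 u2 v2 : L2 D u1 -> L2 D v1 -> L2 D u2 -> L2 D v2 ->
  dot (fun x => u1 x - v1 x) (fun x => u1 x - v1 x) <= (d / 2) ^+ 2 ->
  dot (fun x => u2 x - v2 x) (fun x => u2 x - v2 x) <= (d / 2) ^+ 2 ->
  dot (fun x => (u1 x + u2 x) - (v1 x + v2 x))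
      (fun x => (u1 x + u2 x) - (v1 x + v2 x)) <= d ^+ 2.
Proof.
have E : 2 * ((d / 2) ^+ 2 + (d / 2) ^+ 2) = d ^+ 2 by field.
move=> Lu1 Lv1 Lu2 Lv2 H1 H2; rewrite -E.
apply: le_trans (ler_wpM2l (ler0n _ 2) (lerD H1 H2)).
apply: le_trans (dot_sum_le (L2B mD Lu1 Lv1) (L2B mD Lu2 Lv2)).
rewrite le_eqVlt; apply/orP; left; apply/eqP.
by rewrite /int2; apply: eq_Rintegral => x _; ring.
Qed.

Lemma H10Z (c : R) f : H10 D f -> H10 D (fun x => c * f x).
Proof.
move=> /H10_approx[Lf [g1 [g2 [[L1 L2'] w1 w2 H]]]].
apply: (@approx_H10 _ (fun x => c * g1 x) (fun x => c * g2 x)); rewrite ?[L2 _ _]L2Z//.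
- exact: L2Z.
- exact: L2Z.
- exact: L2Z.
- exact: weak_partialZ.
- exact: weak_partialZ.
move=> d d0; have c1 : 0 < `|c| + 1 by rewrite ltr_wpDl.
have [phi [tphi n0 n1 n2]] := H _ (divr_gt0 d0 c1).
have [C _ _] := tphi.
have Lt := test_L2 tphi.
have Lt1 := test_L2 (test_derive e1 tphi).
have Lt2 := test_L2 (test_derive e2 tphi).
have DE v x : 'D_v (c \*: phi) x = c * 'D_v phi x.
  by rewrite deriveZ//; exact: Ck_derivable (C 1%N).
exists (c \*: phi); split; first exact: testZ.
- exact: approxZ Lf Lt (ltW d0) n0.
- apply: le_trans (approxZ L1 Lt1 (ltW d0) n1); apply: le_of_eq.
  by rewrite /int2; apply: eq_Rintegral => x _; rewrite DE.
- apply: le_trans (approxZ L2' Lt2 (ltW d0) n2); apply: le_of_eq.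
  by rewrite /int2; apply: eq_Rintegral => x _; rewrite DE.
Qed.

Lemma H10D f f' : H10 D f -> H10 D f' -> H10 D (fun x => f x + f' x).
Proof.
move=> /H10_approx[Lf [g1 [g2 [[L1 L2'] w1 w2 H]]]].
move=> /H10_approx[Lf' [g1' [g2' [[L1' L2''] w1' w2' H']]]].
apply: (@approx_H10 _ (fun x => g1 x + g1' x) (fun x => g2 x + g2' x)).
- exact: L2D.
- exact: L2D.
- exact: L2D.
- exact: weak_partialD.
- exact: weak_partialD.
move=> d d0; have d2 : 0 < d / 2 by rewrite divr_gt0.
have [phi [tphi n0 n1 n2]] := H _ d2.
have [psi [tpsi m0 m1 m2]] := H' _ d2.
have [C _ _] := tphi; have [C' _ _] := tpsi.
have Lt := test_L2 tphi.
have Lt1 := test_L2 (test_derive e1 tphi).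
have Lt2 := test_L2 (test_derive e2 tphi).
have Ls := test_L2 tpsi.
have Ls1 := test_L2 (test_derive e1 tpsi).
have Ls2 := test_L2 (test_derive e2 tpsi).
have DE v x : 'D_v (phi + psi) x = 'D_v phi x + 'D_v psi x.
  rewrite deriveD//.
    exact: Ck_derivable (C 1%N).
  exact: Ck_derivable (C' 1%N).
exists (phi + psi); split; first exact: testD.
- exact: approxD Lf Lt Lf' Ls n0 m0.
- apply: le_trans (approxD L1 Lt1 L1' Ls1 n1 m1); apply: le_of_eq.
  by rewrite /int2; apply: eq_Rintegral => x _; rewrite DE.
- apply: le_trans (approxD L2' Lt2 L2'' Ls2 n2 m2); apply: le_of_eq.
  by rewrite /int2; apply: eq_Rintegral => x _; rewrite DE.
Qed.

End H10theory.

Section GuideInequality.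
Variables (R : realType) (theta : R).
Hypotheses (theta_gt0 : 0 < theta) (theta_lt : theta < pi / 2).
Local Notation Omega := (broken_guide theta).
Local Notation n := (mesh_size theta).
Local Notation dot f g := (int2 Omega (fun x => f x * g x)).
Local Notation nrm f := (Num.sqrt (dot f f)).

Definition tile_indic (ij : 'I_n * 'I_n) : R * R -> R :=
  \1_(tile theta (ij.1 : nat, ij.2 : nat)).

Lemma tile_indic_L2 ij : L2 Omega (tile_indic ij).
Proof.
apply: L2_indic; [exact: measurable_guide|exact: measurable_tile|].
by rewrite /tile measure_cell ?ltry//; exact: mesh_gt0.
Qed.

(** Pass to the limit in [test_function_inequality]; the mean of phi over a tile is
    small because that of f vanishes. *)
Lemma H10_inequality f g1 g2 : L2 Omega f -> L2 Omega g1 -> L2 Omega g2 ->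
  H1_approx Omega f g1 g2 -> (forall ij, dot f (tile_indic ij) = 0) ->
  dot f f <= dot g1 g1 + dot g2 g2.
Proof.
have arith (ff pp ef ee p1 p2 a1 a2 S K nf n1 n2 d d2 : R) :
    pp <= p1 + p2 + S -> S <= d * K -> pp = ff - 2 * ef + ee -> `|ef| <= d * nf ->
    0 <= ee -> `|p1 - a1| <= 2 * d * n1 + d2 -> `|p2 - a2| <= 2 * d * n2 + d2 ->
    d2 <= d -> ff <= a1 + a2 + d * (2 * nf + 2 * n1 + 2 * n2 + 2 + K).
  rewrite !ler_norml => H1 H2 H0 /andP[_ H3] H4 /andP[_ H5] /andP[_ H6] H7.
  by lra.
have sq (x d nn h : R) : `|x| <= d * nn -> d ^+ 2 <= d -> 0 <= d -> 0 <= nn ->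
    (x / h) ^+ 2 <= d * (nn / h) ^+ 2.
  move=> xd dd d0 nn0; rewrite !exprMn [leRHS]mulrA; apply: ler_wpM2r; first exact: sqr_ge0.
  rewrite -real_normK ?num_real//.
  apply: le_trans (_ : (d * nn) ^+ 2 <= _); last by rewrite exprMn ler_wpM2r// sqr_ge0.
  by rewrite ler_sqr ?nnegrE// mulr_ge0.
move=> Lf L1 L2' H f0.
have mO := measurable_guide theta.
pose K := \sum_(ij : 'I_n * 'I_n) (nrm (tile_indic ij) / mesh theta) ^+ 2.
have K0 : 0 <= K by apply: sumr_ge0 => ij _; exact: sqr_ge0.
apply: (@le_of_small_error _ _ _ (2 * nrm f + 2 * nrm g1 + 2 * nrm g2 + 2 + K)).
  by rewrite !addr_ge0// ?mulr_ge0// sqrtr_ge0.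
move=> d d0 d1; have [phi [tphi n0 n1 n2]] := H d d0.
have Lt := test_L2 mO tphi.
have Lt1 := test_L2 mO (test_derive (e1 R) tphi).
have Lt2 := test_L2 mO (test_derive (e2 R) tphi).
have dd : d ^+ 2 <= d by rewrite expr2 ler_piMl// ltW.
have d0' := ltW d0.
have B0 := dot_expand mO Lf Lt.
have B0' := dot_le_dist mO (L2B mO Lf Lt) Lf d0' n0.
have B1 := normsq_approx mO L1 Lt1 d0' n1.
have B2 := normsq_approx mO L2' Lt2 d0' n2.
have BS : \sum_(ij : 'I_n * 'I_n) (dot phi (tile_indic ij) / mesh theta) ^+ 2 <= d * K.
  rewrite /K mulr_sumr; apply: ler_sum => ij _.
  have := dot_approx mO Lf Lt (tile_indic_L2 ij) d0' n0.
  rewrite f0 sub0r normrN => B.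
  exact: sq B dd d0' (sqrtr_ge0 _).
have T := test_function_inequality theta_gt0 theta_lt tphi.
have e0 := dot_ge0 Omega (fun x => f x - phi x).
exact: arith T BS B0 B0' e0 B1 B2 dd.
Qed.

Lemma H10_form_le f h : H10 Omega f -> L2 Omega h -> weak_laplacian Omega f h ->
  (forall ij, dot f (tile_indic ij) = 0) -> dot f f <= - dot h f.
Proof.
move=> /(H10_approx (measurable_guide theta))[Lf [g1 [g2 [[L1 L2'] w1 w2 H]]]] Lh wl f0.
apply: le_trans (H10_inequality Lf L1 L2' H f0) _.
exact: (green_le (measurable_guide theta) Lf L1 L2' Lh w1 w2 H wl).
Qed.

End GuideInequality.

From mathcomp Require Import complex.

(** * Counting the eigenvalues below the threshold *)

Section ComplexDomain.
Variables (R : realType).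
Local Notation MR := (measurableTypeR R).
Variable D : set (MR * MR).
Hypothesis mD : measurable D.
Implicit Types (u v f g : R * R -> R[i]) (c : R[i]).
Local Notation dot f g := (int2 D (fun x => f x * g x)).
Local Notation Dom := (@dirichlet_dom R D).

Lemma H10_L2 (f : R * R -> R) : H10 D f -> L2 D f.
Proof. by case. Qed.

Lemma reM c u : re (fun x => c * u x) =
  (fun x => complex.Re c * re u x + (- complex.Im c) * im u x).
Proof.
by apply/funext => x; rewrite /re /im; case: c => a b; case: (u x) => p q /=; ring.
Qed.

Lemma imM c u : im (fun x => c * u x) =
  (fun x => complex.Re c * im u x + complex.Im c * re u x).
Proof.
by apply/funext => x; rewrite /re /im; case: c => a b; case: (u x) => p q /=; ring.
Qed.

Lemma reD u v : re (fun x => u x + v x) = (fun x => re u x + re v x).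
Proof. by apply/funext => x; rewrite /re; case: (u x) => a b; case: (v x). Qed.

Lemma imD u v : im (fun x => u x + v x) = (fun x => im u x + im v x).
Proof. by apply/funext => x; rewrite /im; case: (u x) => a b; case: (v x). Qed.

Lemma DomM c u : Dom u -> Dom (fun x => c * u x).
Proof.
move=> [Hr Hi [f [Lr Li wr wi]]].
have Lu := H10_L2 Hr; have Lu' := H10_L2 Hi.
split.
- by rewrite reM; apply: H10D => //; exact: H10Z.
- by rewrite imM; apply: H10D => //; exact: H10Z.
exists (fun x => c * f x); rewrite /is_laplacian !reM !imM; split.
- by apply: L2D => //; exact: L2Z.
- by apply: L2D => //; exact: L2Z.
- by apply: weak_laplacianD => //; try exact: L2Z; exact: weak_laplacianZ.
- by apply: weak_laplacianD => //; try exact: L2Z; exact: weak_laplacianZ.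
Qed.

Lemma DomD u v : Dom u -> Dom v -> Dom (fun x => u x + v x).
Proof.
move=> [Hr Hi [f [Lr Li wr wi]]] [Hr' Hi' [f' [Lr' Li' wr' wi']]].
have Lu := H10_L2 Hr; have Lu' := H10_L2 Hi.
have Lv := H10_L2 Hr'; have Lv' := H10_L2 Hi'.
split.
- by rewrite reD; apply: H10D.
- by rewrite imD; apply: H10D.
exists (fun x => f x + f' x); rewrite /is_laplacian !reD !imD; split.
- exact: L2D.
- exact: L2D.
- exact: weak_laplacianD.
- exact: weak_laplacianD.
Qed.

Lemma Dom_lincomb (j : nat) (u : 'I_j.+1 -> R * R -> R[i]) (c : 'I_j.+1 -> R[i]) :
  (forall i, Dom (u i)) -> Dom (lincomb u c).
Proof.
move=> Du; rewrite /lincomb.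
have Z : Dom (fun=> 0).
  have -> : (fun=> 0) = (fun x => 0 * u ord0 x) by apply/funext => x; rewrite mul0r.
  exact: DomM.
elim: (index_enum _) => [|i s IH].
  by under [X in Dom X]funext do rewrite big_nil.
under [X in Dom X]funext do rewrite big_cons.
by apply: DomD => //; exact: DomM.
Qed.

Definition pairing u (t : R * R -> R) : R[i] := (dot (re u) t +i* dot (im u) t)%C.

Lemma pairing_lincomb (j : nat) (u : 'I_j.+1 -> R * R -> R[i]) (c : 'I_j.+1 -> R[i])
  (t : R * R -> R) : (forall i, Dom (u i)) -> L2 D t ->
  pairing (lincomb u c) t = \sum_(i < j.+1) c i * pairing (u i) t.
Proof.
move=> Du Lt; rewrite /lincomb.
have pM e v : Dom v -> pairing (fun x => e * v x) t = e * pairing v t.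
  move=> [/H10_L2 L1 /H10_L2 L2' _]; rewrite /pairing reM imM.
  rewrite !(dotDl mD (L2Z mD _ _) (L2Z mD _ _) Lt)// !dotZl//.
  by case: e => a b /=; congr (_ +i* _)%C; ring.
have pD v w : Dom v -> Dom w -> pairing (fun x => v x + w x) t = pairing v t + pairing w t.
  move=> [/H10_L2 L1 /H10_L2 L2' _] [/H10_L2 M1 /H10_L2 M2 _]; rewrite /pairing reD imD.
  by rewrite !dotDl.
have Z : Dom (fun=> 0) /\ pairing (fun=> 0) t = 0.
  have -> : (fun=> 0) = (fun x => 0 * u ord0 x) by apply/funext => x; rewrite mul0r.
  by split; [exact: DomM|rewrite pM// mul0r].
suff : forall s, Dom (fun x => \sum_(i <- s) c i * u i x) /\
  pairing (fun x => \sum_(i <- s) c i * u i x) t = \sum_(i <- s) c i * pairing (u i) t.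
  by move=> H; exact: (H _).2.
elim=> [|i s [IH1 IH2]].
  by under [X in Dom X /\ pairing X _ = _]funext do rewrite big_nil; rewrite big_nil.
under [X in Dom X /\ pairing X _ = _]funext do rewrite big_cons.
have Du' := DomM (c i) (Du i).
by split; [exact: DomD|rewrite pD// pM// IH2 big_cons].
Qed.

Lemma inner_self u : L2 D (re u) -> L2 D (im u) ->
  inner D u u = ((dot (re u) (re u) + dot (im u) (im u)) +i* 0)%C.
Proof.
move=> Lr Li; rewrite /inner; congr (_ +i* _)%C; rewrite /int2.
  rewrite -RintegralD//; [|exact: L2_integrableM|exact: L2_integrableM].
  by apply: eq_Rintegral => x _; rewrite /re /im; case: (u x) => a b /=; ring.
rewrite [LHS](_ : _ = \int[leb2 R]_(x in D) 0); last first.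
  by apply: eq_Rintegral => x _; rewrite /re /im; case: (u x) => a b /=; ring.
by rewrite /Rintegral integral0.
Qed.

Lemma inner_laplacian u f : L2 D (re u) -> L2 D (im u) -> L2 D (re f) -> L2 D (im f) ->
  complex.Re (inner D (- f) u) = - dot (re f) (re u) - dot (im f) (im u).
Proof.
move=> Lr Li Fr Fi; rewrite -opprD.
have -> : dot (re f) (re u) + dot (im f) (im u) =
    int2 D (fun x => re f x * re u x + im f x * im u x).
  by rewrite /int2 RintegralD//; exact: L2_integrableM.
rewrite /inner/= /int2 -[RHS]mulN1r -RintegralZl//; last first.
  exact: (integrableD mD (L2_integrableM mD Fr Lr) (L2_integrableM mD Fi Li)).
apply: eq_Rintegral => x _; rewrite /re /im !fctE.
by case: (u x) => a b; case: (f x) => p q /=; ring.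
Qed.

Lemma dot0_ae (f : R * R -> R) : L2 D f -> dot f f = 0 ->
  {ae leb2 R, forall x, D x -> f x = 0}.
Proof.
move=> Lf f0.
have mf2 : measurable_fun D (fun x => (f x ^+ 2)%:E).
  by apply/measurable_EFinP; apply: measurable_funX; case: Lf.
have [+ _] := ae_eq_integral_abs (leb2 R) mD mf2.
have -> : (\int[leb2 R]_(x in D) `|(f x ^+ 2)%:E| = 0)%E.
  apply: (@etrans _ _ (dot f f)%:E); last by rewrite f0.
  rewrite -(dotE mD Lf).
  by apply: eq_integral => x _; rewrite gee0_abs// lee_fin sqr_ge0.
move=> /(_ erefl); apply: filterS => x H Dx.
by have /= [/eqP] := H Dx; rewrite sqrf_eq0 => /eqP.
Qed.

End ComplexDomain.

Section Final.
Variables (R : realType) (theta : R).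
Hypotheses (theta_gt0 : 0 < theta) (theta_lt : theta < pi / 2).
Local Notation Omega := (broken_guide theta).
Local Notation n := (mesh_size theta).
Local Notation Dom := (@dirichlet_dom R Omega).
Local Notation A := (@dirichlet_laplacian R Omega).

(** Apply the real inequality to the real and imaginary parts. Whatever representative
    of the Laplacian [xget] picks, it satisfies the weak equation. *)
Lemma rayleigh_quotient_ge1 w : Dom w -> ~ ae_zero Omega w ->
  (forall ij, pairing Omega w (@tile_indic R theta ij) = 0) ->
  1 <= rayleigh_quotient Omega A w.
Proof.
have mO := measurable_guide theta.
move=> Dw nz w0; have [Hr Hi ex] := Dw.
have Lr := H10_L2 Hr; have Li := H10_L2 Hi.
rewrite /rayleigh_quotient /dirichlet_laplacian.
have := @xgetPex _ 0 [set f | is_laplacian Omega w f] ex.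
move: (xget _ _) => f [Fr Fi wr wi].
have wr0 (ij : 'I_n * 'I_n) : int2 Omega (fun x => re w x * tile_indic ij x) = 0.
  by have := w0 ij => -[].
have wi0 (ij : 'I_n * 'I_n) : int2 Omega (fun x => im w x * tile_indic ij x) = 0.
  by have := w0 ij => -[].
have Qr := H10_form_le theta_gt0 theta_lt Hr Fr wr wr0.
have Qi := H10_form_le theta_gt0 theta_lt Hi Fi wi wi0.
have IE := inner_laplacian mO Lr Li Fr Fi.
rewrite inner_self//.
move: IE; case: (inner _ _ _) => p q /= ->.
have p0 := dot_ge0 Omega (re w); have q0 := dot_ge0 Omega (im w).
have pq : 0 < int2 Omega (fun x => re w x * re w x) + int2 Omega (fun x => im w x * im w x).
  rewrite lt_neqAle addr_ge0// andbT eq_sym paddr_eq0//; apply/negP => /andP[/eqP r0 /eqP i0].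
  apply: nz; have ar := dot0_ae mO Lr r0; have ai := dot0_ae mO Li i0.
  apply: filterS2 ar ai => x r i Ox; move: (r Ox) (i Ox); rewrite /re /im.
  by case: (w x) => a b /= -> ->.
move: p0 q0 pq Qr Qi.
move: (int2 _ _) (int2 _ _) (int2 _ _) (int2 _ _) => {p} a b c d.
move=> d0 c0 dc db ca.
rewrite expr0n addr0 mul0r oppr0 mulr0 subr0.
have -> : (- b - a) * ((d + c) / (d + c) ^+ 2) = (- b - a) / (d + c).
  by field; rewrite gt_eqF.
by rewrite ler_pdivlMr// mul1r; lra.
Qed.

(** More vectors than tiles: the matrix of pairings has a nonzero row vector in its
    kernel, giving a combination with vanishing means. *)
Lemma rayleigh_lt1_le_tiles j : (1 <= j)%N -> (rayleigh Omega Dom A j < 1%:E)%E ->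
  (j <= #|{: 'I_n * 'I_n}|)%N.
Proof.
have mO := measurable_guide theta.
case: j => // j _ /ereal_inf_lt[_ [u [Du iu] <-]] sup1.
rewrite leqNgt; apply/negP => tj.
pose t (k : 'I_#|{: 'I_n * 'I_n}|) := @tile_indic R theta (enum_val k).
pose M : 'M[R[i]]_(j.+1, #|{: 'I_n * 'I_n}|) := \matrix_(i, k) pairing Omega (u i) (t k).
have : kermx M != 0.
  rewrite kermx_eq0 /row_free; apply: contraTneq tj => <-.
  by rewrite -leqNgt rank_leq_col.
move=> /rowV0Pn[v /sub_kermxP vM v0].
pose c i := v 0 i.
have Dw : Dom (lincomb u c) by exact: Dom_lincomb.
have nz : ~ ae_zero Omega (lincomb u c).
  by move=> /iu c0; case/eqP: v0; apply/rowP => i; rewrite mxE -[LHS]/(c i) c0.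
have : 1 <= rayleigh_quotient Omega A (lincomb u c).
  apply: rayleigh_quotient_ge1 => // ij.
  rewrite pairing_lincomb//; last exact: tile_indic_L2.
  have /matrixP/(_ 0 (enum_rank ij)) := vM.
  rewrite !mxE => vMij; rewrite -[RHS]vMij; apply: eq_bigr => i _.
  by rewrite mxE /t enum_rankK.
apply/negP; rewrite -ltNge -lte_fin; apply: le_lt_trans sup1.
by apply: ereal_sup_ubound; exists (lincomb u c) => //; split => //; exists c.
Qed.

End Final.

Theorem proposition5p1 (R : realType) (theta : R)
    (theta_gt0 : 0 < theta) (theta_lt : theta < pi / 2) :
  counting_number (broken_guide theta)
    (@dirichlet_dom R (broken_guide theta))
    (@dirichlet_laplacian R (broken_guide theta)) 1 \is a fin_num.
Proof.
rewrite ge0_fin_numE; last first.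
  by apply: ereal_sup_ubound; exists 0%N => //; left.
apply: (@le_lt_trans _ _ (#|{: 'I_(mesh_size theta) * 'I_(mesh_size theta)}|%:R%:E)%E).
  apply: ge_ereal_sup => _ [j [->|[j1 jr]] <-].
    by rewrite lee_fin.
  rewrite lee_fin ler_nat.
  exact: rayleigh_lt1_le_tiles theta_gt0 theta_lt _ j1 jr.
exact: ltry.
Qed.
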